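(* Let $k$ be a field, let $G$ be an unmixed Ferrers graph with associated partition $\lambda=(\lambda_1,\lambda_2,\ldots,\lambda_n)$, and let $I_\lambda$ be the edge ideal of $G$ in $R=k[x_1,\ldots,x_n,y_1,\ldots,y_n]$. Then $I_\lambda$ is almost Cohen-Macaulay if and only if $I_\lambda$ is connected in codimension two.
   Context: Given a positive integer $n$ and an $n$-tuple $\lambda=(\lambda_1,\ldots,\lambda_n)$ of positive integers with $m=\lambda_1\geq\lambda_2\geq\cdots\geq\lambda_n$, the Ferrers graph $G=G_\lambda$ associated to $\lambda$ is the bipartite graph with bipartition $V_1=\{x_1,\ldots,x_n\}$ and $V_2=\{y_1,\ldots,y_m\}$ in which $\{x_i,y_j\}$ is an edge if and only if $j\leq\lambda_i$ (so if $\{x_i,y_j\}$ is an edge, then so is $\{x_r,y_s\}$ for all $1\leq r\leq i$ and $1\leq s\leq j$). Its edge ideal is $I_\lambda=(x_iy_j : \{x_i,y_j\}\in E(G))\subseteq k[x_1,\ldots,x_n,y_1,\ldots,y_m]$. A graph is unmixed if all its minimal vertex covers (subsets of vertices meeting every edge, minimal under inclusion) have the same cardinality. For an unmixed bipartite graph without isolated vertices the two parts of the bipartition have the same cardinality, so here $m=n$. $I_\lambda$ is called almost Cohen-Macaulay (aCM) if $\operatorname{depth} R/I_\lambda\geq\dim R/I_\lambda-1$. A monomial ideal $I\subset R$ is connected in codimension $t$ (for a non-negative integer $t$) if for any pair of distinct minimal prime ideals $\mathfrak p,\mathfrak q$ of $I$ there exists a sequence $\mathfrak p=\mathfrak p_1,\mathfrak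 p_2,\ldots,\mathfrak p_r=\mathfrak q$ of minimal prime ideals of $I$ such that $\operatorname{ht}(\mathfrak p_i+\mathfrak p_{i+1})\leq\operatorname{ht}(I)+t$ for each $1\leq i\leq r-1$. *)

(* Defs.v *)
From mathcomp Require Import all_boot all_order all_algebra.
From mathcomp.multinomials Require Export mpoly.

Set Implicit Arguments.
Unset Strict Implicit.
Unset Printing Implicit Defensive.

Import GRing.Theory.

Definition is_maximum (S : nat -> Prop) (d : nat) : Prop :=
  S d /\ forall e, S e -> e <= d.

Definition is_minimum (S : nat -> Prop) (d : nat) : Prop :=
  S d /\ forall e, S e -> d <= e.

(* Ideals are Prop-valued predicates: ring_quotient's [idealr] and
   [prime_idealr] only cover ideals with a boolean membership test, whereas
   chains of primes must range over all prime ideals. *)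
Section Ideals.

Variable R : comNzRingType.
Local Open Scope ring_scope.

Implicit Types (I J P Q S : R -> Prop) (s : seq R).

Definition sub_ideal I J : Prop := forall x, I x -> J x.

Definition eq_ideal I J : Prop := forall x, I x <-> J x.

Definition is_ideal I : Prop :=
  [/\ I 0, (forall x y, I x -> I y -> I (x + y))
    & (forall a x, I x -> I (a * x))].

Definition ideal_gen S : R -> Prop :=
  fun x => forall J, is_ideal J -> sub_ideal S J -> J x.

Definition ideal_add I J : R -> Prop :=
  fun z => exists x y, [/\ I x, J y & z = x + y].

Definition is_prime P : Prop :=
  [/\ is_ideal P, ~ P 1 & forall x y, P (x * y) -> P x \/ P y].

Definition is_minimal_prime I P : Prop :=
  [/\ is_prime P, sub_ideal I P
    & forall Q, is_prime Q -> sub_ideal I Q -> sub_ideal Q P -> sub_ideal P Q].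

Definition prime_chain (c : nat -> R -> Prop) (d : nat) : Prop :=
  (forall i, (i <= d)%N -> is_prime (c i)) /\
  (forall i, (i < d)%N -> sub_ideal (c i) (c i.+1) /\ ~ sub_ideal (c i.+1) (c i)).

(* The Krull dimension of R/I: the primes of R/I are the primes of R
   containing I. *)
Definition is_quotient_dim I (d : nat) : Prop :=
  is_maximum (fun e => exists c, prime_chain c e /\ sub_ideal I (c 0%N)) d.

Definition is_prime_height P (h : nat) : Prop :=
  is_maximum (fun e => exists c, prime_chain c e /\ c e = P) h.

(* The unit ideal has no height in this sense (the usual convention gives it
   height infinity). *)
Definition is_height I (h : nat) : Prop :=
  is_minimum
    (fun e => exists P, [/\ is_prime P, sub_ideal I P & is_prime_height P e]) h.

(* [s] is an (R/I)-regular sequence: each s_i is a nonzerodivisor on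
   R/(I + (s_0, ..., s_(i-1))), and R/(I + (s)) is nonzero. *)
Definition quotient_regular I s : Prop :=
  (forall i, (i < size s)%N -> forall g,
     ideal_add I (ideal_gen (fun f => f \in take i s)) (s`_i * g) ->
     ideal_add I (ideal_gen (fun f => f \in take i s)) g) /\
  ~ ideal_add I (ideal_gen (fun f => f \in s)) 1.

Definition connected_in_codim (t : nat) I : Prop :=
  forall P Q, is_minimal_prime I P -> is_minimal_prime I Q -> ~ eq_ideal P Q ->
  exists (r : nat) (c : nat -> R -> Prop),
    [/\ c 0%N = P, c r = Q,
        forall i, (i <= r)%N -> is_minimal_prime I (c i)
      & forall i, (i < r)%N ->
          exists hI h, [/\ is_height I hI,
                           is_height (ideal_add (c i) (c i.+1)) h
                         & (h <= hI + t)%N]].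

End Ideals.

Section Depth.

Variables (k : fieldType) (N : nat).
Local Open Scope ring_scope.

Implicit Type I : {mpoly k[N]} -> Prop.

(* The depth of R/I over R = k[X_0, ..., X_(N-1)] is taken with respect to the
   irrelevant maximal ideal, i.e. the polynomials with no constant term. *)
Definition is_quotient_depth I (d : nat) : Prop :=
  is_maximum
    (fun e => exists s : seq {mpoly k[N]},
       [/\ size s = e, (forall f, f \in s -> f@_0%MM = 0)
         & quotient_regular I s]) d.

Definition almost_CM I : Prop :=
  exists depth dim : nat,
    [/\ is_quotient_depth I depth, is_quotient_dim I dim & (dim - 1 <= depth)%N].

End Depth.

Section Graphs.

Variables (T : finType) (e : rel T).

Definition vertex_cover (C : {set T}) : bool :=
  [forall u, forall v, e u v ==> (u \in C) || (v \in C)].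

Definition unmixed : Prop :=
  forall C D : {set T},
    minset vertex_cover C -> minset vertex_cover D -> #|C| = #|D|.

End Graphs.

Section Ferrers.

Variables (n m : nat) (la : n.-tuple nat).

(* [inl i] is the vertex x_(i+1) and [inr j] the vertex y_(j+1), so that the
   condition j+1 <= lambda_(i+1) reads [j < tnth la i]. *)
Definition ferrers_graph : rel ('I_n + 'I_m) :=
  fun u v => match u, v with
             | inl i, inr j | inr j, inl i => j < tnth la i
             | _, _ => false
             end.

Local Open Scope ring_scope.

(* In {mpoly k[n + m]} the first n variables are x_1, ..., x_n and the last m
   ones are y_1, ..., y_m. *)
Definition ferrers_ideal (k : fieldType) : {mpoly k[n + m]} -> Prop :=
  ideal_gen (fun f => exists i j,
    ferrers_graph (inl i) (inr j) /\ f = 'X_(lshift m i) * 'X_(rshift n j)).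

End Ferrers.

(* Main.v *)
Require Import Defs.
From mathcomp Require Import all_boot all_order all_algebra.
From mathcomp Require Import zify ring.
From Stdlib Require Import Classical FunctionalExtensionality PropExtensionality.

Set Implicit Arguments.
Unset Strict Implicit.
Unset Printing Implicit Defensive.

Import GRing.Theory.

(** Unmixedness forces m = n and pins down the minimal vertex covers: they are
    the sets C_a made of x_1, ..., x_a and y_1, ..., y_(n-a), for the corners a
    of the partition, i.e. those 0 <= a <= n with lambda_(a+1) = n - a
    (lambda_(n+1) = 0); 0 and n are corners.  Hence the minimal primes of the
    radical ideal I are the primes P_a generated by the variables in C_a, they
    all have height n, and for corners a <= b the ideal P_a + P_b is generated
    by n + (b - a) variables.  Both properties of the theorem turn out to say
    that consecutive corners differ by at most two ([small_gaps]).

    For connectedness this is a walk along the corners: a path of minimal primes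
    that starts below a gap and ends above it has to jump over the gap, and the
    height of the sum at that jump is at least n plus the length of the gap
    ([connected_small_gaps], [small_gaps_connected]).  The heights and the
    dimension of R/I come from the bound N on the length of chains of primes in
    k[X_1, ..., X_N] ([prime_chain_leq]).  Its proof is a count: along a chain
    of length d one finds f_1, ..., f_d all of whose monomials with exponents at
    most M are linearly independent, and for large M these (M + 1)^d elements of
    degree at most DM do not fit in a space of dimension (DM + 1)^N unless
    d <= N.

    For depth, write a gap b < b' of consecutive corners as I = J cap K with
    J + K = P_b + P_b'.  The exact sequence
    0 -> R/I -> R/J (+) R/K -> R/(J + K) -> 0 gives a nonzero Koszul cohomology
    class of R/I, written down explicitly in [regular_size_leq], in degree
    n - (b' - b) + 1; Koszul cohomology vanishes below the length of any regular
    sequence ([koszul_acyclic]), so that the depth is at most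
    n - (b' - b) + 1.  In particular a gap of length three or more makes it at
    most n - 2, while dim R/I = n.

    Conversely, if all gaps are at most two, then with
    z_j = x_j + y_(n+1-j) and z_(n+1) = 0 the n - 1 forms z_j - z_(j+2) are a
    regular sequence.  On each R/P_a and R/(P_a + P_b) regularity of linear forms
    is linear independence ([linear_regular]), and the same exact sequences glue
    these quotients together ([weakly_regular_cap], [corners_upto_regular]). *)

(** * Ideals and regular sequences *)

Section IdealTheory.

Variable R : comNzRingType.
Local Open Scope ring_scope.

Implicit Types (I J K P Q S : R -> Prop) (f g x y z : R) (s : seq R).

Lemma eq_idealP I J : eq_ideal I J -> I = J.
Proof.
move=> eqIJ; apply: functional_extensionality => x.
exact/propositional_extensionality/eqIJ.
Qed.

Lemma ideal_zero I : is_ideal I -> I 0. Proof. by case. Qed.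

Lemma ideal_plus I x y : is_ideal I -> I x -> I y -> I (x + y).
Proof. by case=> _ ID _; apply: ID. Qed.

Lemma ideal_mull I x y : is_ideal I -> I y -> I (x * y).
Proof. by case=> _ _; apply. Qed.

Lemma ideal_mulr I x y : is_ideal I -> I x -> I (x * y).
Proof. by rewrite mulrC; apply: ideal_mull. Qed.

Lemma ideal_opp I x : is_ideal I -> I x -> I (- x).
Proof. by rewrite -mulN1r; apply: ideal_mull. Qed.

Lemma ideal_minus I x y : is_ideal I -> I x -> I y -> I (x - y).
Proof. by move=> iI Ix Iy; apply: ideal_plus => //; apply: ideal_opp. Qed.

Lemma ideal_sum I (T : Type) (r : seq T) (p : pred T) (F : T -> R) :
  is_ideal I -> (forall i, p i -> I (F i)) -> I (\sum_(i <- r | p i) F i).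
Proof.
move=> iI IF; elim/big_ind: _ => //; first exact: ideal_zero.
by move=> x y; apply: ideal_plus.
Qed.

Lemma ideal_congr I x y : is_ideal I -> I (x - y) -> I y -> I x.
Proof. by move=> iI Ixy Iy; rewrite -(subrK y x); apply: ideal_plus. Qed.

Lemma ideal_gen_ideal S : is_ideal (ideal_gen S).
Proof.
split=> [J iJ _|x y Sx Sy J iJ SJ|a x Sx J iJ SJ]; first exact: ideal_zero.
- by apply: ideal_plus; [|apply: Sx|apply: Sy].
- by apply: ideal_mull; [|apply: Sx].
Qed.

Lemma ideal_add_ideal I J : is_ideal I -> is_ideal J -> is_ideal (ideal_add I J).
Proof.
move=> iI iJ; split=> [|x y [a [b [Ia Jb ->]]] [c [d [Ic Jd ->]]]
                      |a x [b [c [Ib Jc ->]]]].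
- by exists 0, 0; split; [exact: ideal_zero|exact: ideal_zero|rewrite addr0].
- by exists (a + c), (b + d); split; [exact: ideal_plus|exact: ideal_plus|rewrite addrACA].
- by exists (a * b), (a * c); split; [exact: ideal_mull|exact: ideal_mull|rewrite mulrDr].
Qed.

Lemma ideal_addl I J : is_ideal J -> sub_ideal I (ideal_add I J).
Proof. by move=> iJ x Ix; exists x, 0; split; rewrite ?addr0 //; apply: ideal_zero. Qed.

Lemma ideal_addr I J : is_ideal I -> sub_ideal J (ideal_add I J).
Proof. by move=> iI x Jx; exists 0, x; split; rewrite ?add0r //; apply: ideal_zero. Qed.

Lemma ideal_add_min I J K :
  is_ideal K -> sub_ideal I K -> sub_ideal J K -> sub_ideal (ideal_add I J) K.
Proof. by move=> iK IK JK _ [x [y [/IK Kx /JK Ky ->]]]; apply: ideal_plus. Qed.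

Definition ideal_cap I J : R -> Prop := fun x => I x /\ J x.

Definition adjoin I f : R -> Prop :=
  fun z => exists x g, I x /\ z = x + g * f.

Lemma adjoin_ideal I f : is_ideal I -> is_ideal (adjoin I f).
Proof.
move=> iI; split=> [|_ _ [x [g [Ix ->]]] [y [h [Iy ->]]]|a _ [x [g [Ix ->]]]].
- by exists 0, 0; split; [exact: ideal_zero|rewrite mul0r addr0].
- by exists (x + y), (g + h); split; [exact: ideal_plus|rewrite mulrDl addrACA].
- by exists (a * x), (a * g); split; [exact: ideal_mull|rewrite mulrDr mulrA].
Qed.

Lemma sub_adjoin I f : sub_ideal I (adjoin I f).
Proof. by move=> x Ix; exists x, 0; rewrite mul0r addr0. Qed.

Lemma mem_adjoin I f : is_ideal I -> adjoin I f f.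
Proof. by move=> iI; exists 0, 1; rewrite mul1r add0r; split=> //; apply: ideal_zero. Qed.

Lemma adjoin_min I J f :
  is_ideal J -> sub_ideal I J -> J f -> sub_ideal (adjoin I f) J.
Proof.
move=> iJ IJ Jf _ [x [g [/IJ Jx ->]]]; apply: ideal_plus => //; exact: ideal_mull.
Qed.

Definition adjoins I s : R -> Prop := foldl adjoin I s.

Lemma adjoins_ideal I s : is_ideal I -> is_ideal (adjoins I s).
Proof. by elim: s I => //= f s IHs I iI; apply/IHs/adjoin_ideal. Qed.

Lemma sub_adjoins I s : sub_ideal I (adjoins I s).
Proof.
by elim: s I => [|f s IHs] I x Ix //=; apply: IHs; apply: sub_adjoin.
Qed.

Lemma mem_adjoins I s f : is_ideal I -> f \in s -> adjoins I s f.
Proof.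
elim: s I => //= g s IHs I iI; rewrite inE => /predU1P[->|sf]; last first.
  exact: IHs (adjoin_ideal g iI) sf.
exact/sub_adjoins/mem_adjoin.
Qed.

Lemma adjoins_min I J s :
    is_ideal J -> sub_ideal I J -> (forall f, f \in s -> J f) ->
  sub_ideal (adjoins I s) J.
Proof.
move=> iJ; elim: s I => //= f s IHs I IJ sJ; apply: IHs => [|g sg].
  by apply: adjoin_min => //; apply: sJ; rewrite mem_head.
by apply: sJ; rewrite inE sg orbT.
Qed.

Lemma ideal_add_gen I s :
  is_ideal I -> ideal_add I (ideal_gen (fun f => f \in s)) = adjoins I s.
Proof.
move=> iI; apply: eq_idealP => x; split; move: x.
  apply: ideal_add_min; [exact: adjoins_ideal|exact: sub_adjoins|].
  move=> x; apply; first exact: adjoins_ideal.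
  by move=> f; apply: mem_adjoins.
have iG := ideal_gen_ideal (fun f => f \in s).
apply: adjoins_min; [exact: ideal_add_ideal|exact: ideal_addl|].
by move=> f sf; apply: ideal_addr => // J _; apply.
Qed.

Definition nonzerodivisor_mod I f : Prop := forall g, I (f * g) -> I g.

(** [quotient_regular] without properness, as a recursion on the sequence: both
    depth inequalities are proved by dividing by one element at a time. *)
Fixpoint weakly_regular I s : Prop :=
  if s is f :: s' then nonzerodivisor_mod I f /\ weakly_regular (adjoin I f) s'
  else True.

Lemma weakly_regularP I s :
  weakly_regular I s <->
  forall i, (i < size s)%N -> nonzerodivisor_mod (adjoins I (take i s)) s`_i.
Proof.
elim: s I => [|f s IHs] I //=; split=> [[reg_f /IHs reg_s] [|i] //|reg_fs].
  exact: reg_s.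
by split; [exact: (reg_fs 0%N)|apply/IHs => i; apply: (reg_fs i.+1)].
Qed.

Lemma quotient_regularE I s :
  is_ideal I -> quotient_regular I s <-> weakly_regular I s /\ ~ adjoins I s 1.
Proof.
move=> iI; rewrite /quotient_regular ideal_add_gen // weakly_regularP.
by split=> -[reg_s proper_s]; split=> // i i_lt g; have := reg_s i i_lt g;
   rewrite ideal_add_gen.
Qed.

(** The depth lemma for the exact sequence
    0 -> R/(J cap K) -> R/J (+) R/K -> R/(J + K) -> 0: dividing the sequence by
    an element that is regular on all three quotients keeps it exact, i.e.
    (J cap K) + (f) = (J + (f)) cap (K + (f)), so one can induct.  The last
    element only has to be regular on the submodule R/(J cap K). *)
Lemma weakly_regular_cap J K s :
    is_ideal J -> is_ideal K -> weakly_regular J s -> weakly_regular K s ->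
    weakly_regular (ideal_add J K) (take (size s).-1 s) ->
  weakly_regular (ideal_cap J K) s.
Proof.
elim: s J K => //= f s IHs J K iJ iK [regJ regJs] [regK regKs] regJK; split.
  by move=> g [/regJ Jg /regK Kg].
case: s => // f' s in IHs regJs regKs regJK *; case: regJK => regJK regJKs.
have iJK := ideal_add_ideal iJ iK.
have iJf := adjoin_ideal f iJ; have iKf := adjoin_ideal f iK.
have ->: adjoin (ideal_cap J K) f = ideal_cap (adjoin J f) (adjoin K f).
  apply: eq_idealP => z; split=> [[x [g [[Jx Kx] ->]]]|].
    by split; exists x, g.
  case=> -[j [r [Jj zE]]] [h [s' [Kh zE']]].
  have hE : h = j + r * f - s' * f by rewrite -zE zE' addrK.
  (* the two ways of writing z modulo f give f (r - s') in J + K *)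
  have [j' [h' [Jj' Kh' rsE]]] : ideal_add J K (r - s').
    apply: regJK; exists (- j), h; split=> //; first exact: ideal_opp.
    by rewrite hE; ring.
  exists (j + f * j'), (r - j'); split; last by rewrite zE; ring.
  split; first by apply: ideal_plus => //; apply: ideal_mull.
  have ->: j + f * j' = h - f * h'.
    have ->: j' = r - s' - h' by rewrite rsE addrK.
    by rewrite hE; ring.
  by apply: ideal_minus => //; apply: ideal_mull.
apply: IHs => //=.
have -> : ideal_add (adjoin J f) (adjoin K f) = adjoin (ideal_add J K) f.
  have iJKf := adjoin_ideal f iJK.
  apply: eq_idealP => z; split; move: z.
    apply: ideal_add_min => //; apply: adjoin_min => //; try exact: mem_adjoin.
      by move=> x Jx; apply/sub_adjoin/ideal_addl.
    by move=> x Kx; apply/sub_adjoin/ideal_addr.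
  apply: adjoin_min; first exact: ideal_add_ideal.
    apply: ideal_add_min; first exact: ideal_add_ideal.
      by move=> x Jx; apply: ideal_addl => //; apply: sub_adjoin.
    by move=> x Kx; apply: ideal_addr => //; apply: sub_adjoin.
  by apply: ideal_addl => //; apply: mem_adjoin.
exact: regJKs.
Qed.

End IdealTheory.

(** * Ideals generated by linear forms *)

Section LinearIdeals.

Variables (k : fieldType) (N : nat).
Local Open Scope ring_scope.

Local Notation R := {mpoly k[N]}.

Implicit Types (J : R -> Prop) (t u : N.-tuple R) (f g : R) (s : seq R)
  (c : 'I_N -> k) (S T : {set 'I_N}).

Lemma ideal_prod_congr J (r : seq 'I_N) (F G : 'I_N -> R) :
    is_ideal J -> (forall i, J (F i - G i)) ->
  J (\prod_(i <- r) F i - \prod_(i <- r) G i).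
Proof.
move=> iJ JFG; elim: r => [|i r IHr].
  by rewrite !big_nil subrr; apply: ideal_zero.
rewrite !big_cons.
have -> : F i * \prod_(j <- r) F j - G i * \prod_(j <- r) G j =
    \prod_(j <- r) F j * (F i - G i)
    + G i * (\prod_(j <- r) F j - \prod_(j <- r) G j) by ring.
by apply: ideal_plus => //; apply: ideal_mull.
Qed.

Lemma ideal_exp_congr J f g n : is_ideal J -> J (f - g) -> J (f ^+ n - g ^+ n).
Proof. by move=> iJ Jfg; rewrite subrXX; apply: ideal_mulr. Qed.

Lemma ideal_scale J a f : is_ideal J -> J f -> J (a *: f).
Proof. by move=> iJ Jf; rewrite -mul_mpolyC; apply: ideal_mull. Qed.

Lemma subst_congr J t f :
  is_ideal J -> (forall v, J ('X_v - tnth t v)) -> J (f - (f \mPo t)).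
Proof.
move=> iJ Jt; rewrite comp_mpolyEX {1}[f]mpolyE -sumrB.
apply: ideal_sum => // m _; rewrite -scalerBr; apply: ideal_scale => //.
rewrite comp_mpolyX mpolyXE_id; apply: ideal_prod_congr => // v.
exact: ideal_exp_congr.
Qed.

Definition zero_ideal : R -> Prop := fun f => f = 0.

Lemma zero_ideal_ideal : is_ideal zero_ideal.
Proof.
split=> // [x y -> ->|a x ->]; first exact: addr0.
exact: mulr0.
Qed.

Lemma sub_zero_ideal J : is_ideal J -> sub_ideal zero_ideal J.
Proof. by move=> iJ _ ->; apply: ideal_zero. Qed.

Definition linear_form c : R := \sum_v c v *: 'X_v.

Definition is_linear_form f : Prop := exists c, f = linear_form c.

Lemma linear_form_delta v : 'X_v = linear_form (fun w => (w == v)%:R).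
Proof.
rewrite /linear_form (bigD1 v) //= eqxx scale1r big1 ?addr0 // => w /negPf->.
by rewrite scale0r.
Qed.

Lemma linear_form_comp c t :
  linear_form c \mPo t = \sum_v c v *: tnth t v.
Proof.
rewrite raddf_sum; apply: eq_bigr => v _ /=.
by rewrite comp_mpolyZ comp_mpolyXU (tnth_nth 0).
Qed.

Lemma linear_formB c c' :
  linear_form c - linear_form c' = linear_form (fun v => c v - c' v).
Proof. by rewrite -sumrB; apply: eq_bigr => v _; rewrite scalerBl. Qed.

Lemma is_linear_form_sum c t :
    (forall v, is_linear_form (tnth t v)) ->
  is_linear_form (\sum_v c v *: tnth t v).
Proof.
move=> /fin_all_exists[d td]; exists (fun w => \sum_v c v * d v w).
rewrite (eq_bigr _ (fun v _ => congr1 (fun z => c v *: z) (td v))).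
under eq_bigr do rewrite /linear_form scaler_sumr.
rewrite exchange_big; apply: eq_bigr => w _ /=.
by rewrite scaler_suml; apply: eq_bigr => v _; rewrite scalerA.
Qed.

Lemma meval_linear_form c p : (linear_form c).@[p] = \sum_v c v * p v.
Proof.
by rewrite raddf_sum; apply: eq_bigr => v _ /=; rewrite mevalZ mevalXU.
Qed.

Lemma adjoins_rcons J s f : adjoins J (rcons s f) = adjoin (adjoins J s) f.
Proof. by rewrite /adjoins -cats1 foldl_cat. Qed.

Lemma kernel_ideal t : is_ideal (fun f => f \mPo t = 0).
Proof.
split=> [|x y|a x]; first exact: comp_mpoly0.
  by rewrite comp_mpolyD => -> ->; rewrite addr0.
by rewrite rmorphM /= => ->; rewrite mulr0.
Qed.

(** Gaussian elimination: a further linear form, once reduced by the current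
    substitution, either vanishes or can be solved for one of its variables,
    and composing with that elimination gives the next substitution. *)
Lemma linear_elimination s :
    (forall f, f \in s -> is_linear_form f) ->
  exists t, [/\ forall v, is_linear_form (tnth t v),
                forall v, adjoins zero_ideal s ('X_v - tnth t v)
              & forall f, f \in s -> f \mPo t = 0].
Proof.
elim/last_ind: s => [|s l IHs] lin_sl.
  exists [tuple 'X_v | v < N]; split=> // v; rewrite tnth_mktuple.
    by exists (fun w => (w == v)%:R); apply: linear_form_delta.
  exact: subrr.
have lin_s f : f \in s -> is_linear_form f.
  by move=> sf; apply: lin_sl; rewrite mem_rcons inE sf orbT.
have [c lE] : is_linear_form l by apply: lin_sl; rewrite mem_rcons mem_head.
have [t [lin_t Jt s0]] := IHs lin_s.
have iJ := adjoins_ideal s zero_ideal_ideal.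
have iJl := adjoin_ideal l iJ; rewrite adjoins_rcons.
set J := adjoins zero_ideal s in Jt iJ iJl *.
have [c' qE] : is_linear_form (l \mPo t).
  by rewrite lE linear_form_comp; apply: is_linear_form_sum.
have Jq : adjoin J l (linear_form c').
  apply: (@ideal_congr _ _ _ l) => //; last exact: mem_adjoin.
  rewrite -qE -opprB; apply: ideal_opp => //; apply: sub_adjoin.
  exact: subst_congr.
have [w c'w|c'0] := pickP (fun v => c' v != 0); last first.
  exists t; split=> // [v|f]; first exact: sub_adjoin.
  rewrite mem_rcons inE => /predU1P[->|/s0 //].
  by rewrite qE /linear_form big1 // => v _; rewrite (eqP (negbFE (c'0 v))) scale0r.
pose u := [tuple 'X_v - ((v == w)%:R / c' w) *: linear_form c' | v < N].
have lin_u v : is_linear_form (tnth u v).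
  rewrite tnth_mktuple linear_form_delta {2}/linear_form scaler_sumr -sumrB.
  exists (fun x => (x == v)%:R - (v == w)%:R / c' w * c' x).
  by apply: eq_bigr => x _; rewrite scalerBl scalerA.
have comp_linear f : is_linear_form f ->
    f \mPo [tuple tnth t v \mPo u | v < N] = (f \mPo t) \mPo u.
  case=> d ->; rewrite !linear_form_comp raddf_sum; apply: eq_bigr => v _ /=.
  by rewrite tnth_mktuple comp_mpolyZ.
exists [tuple tnth t v \mPo u | v < N]; split=> [v|v|f].
- rewrite tnth_mktuple; have [d ->] := lin_t v.
  by rewrite linear_form_comp; apply: is_linear_form_sum.
- rewrite tnth_mktuple; apply: (@ideal_congr _ _ _ ('X_v - tnth t v)) => //.
    rewrite opprB addrC addrA subrK; apply: subst_congr => // x.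
    by rewrite tnth_mktuple opprB addrC subrK; apply: ideal_scale.
  exact: sub_adjoin.
rewrite mem_rcons inE => /predU1P[->|sf]; last first.
  by rewrite comp_linear ?s0 ?comp_mpoly0 //; apply: lin_s.
rewrite comp_linear; last by exists c.
rewrite qE linear_form_comp.
under eq_bigr do rewrite tnth_mktuple scalerBr scalerA.
rewrite sumrB -/(linear_form c') -scaler_suml (bigD1 w) //= eqxx big1 => [|v /negPf->]; last first.
  by rewrite mul0r mulr0.
by rewrite addr0 mulrC divfK // scale1r subrr.
Qed.

(** The ideal is the kernel of the substitution found by elimination, which maps
    into a domain. *)
Lemma linear_prime s :
  (forall f, f \in s -> is_linear_form f) -> is_prime (adjoins zero_ideal s).
Proof.
move=> /linear_elimination[t [_ Jt s0]].
have iJ := adjoins_ideal s zero_ideal_ideal.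
have JE f : adjoins zero_ideal s f <-> f \mPo t = 0.
  split; last first.
    by move=> ft0; rewrite -[f]subr0 -ft0; apply: subst_congr.
  apply: (adjoins_min (kernel_ideal t) _ s0) => _ ->; exact: comp_mpoly0.
split=> //; first by rewrite JE comp_mpoly1 => /eqP; rewrite oner_eq0.
move=> x y; rewrite !JE rmorphM /= => /eqP; rewrite mulf_eq0.
by case/orP=> /eqP; [left|right].
Qed.

(** Regularity of linear forms is linear independence, witnessed here by points:
    each quotient is a domain, in which a linear form is a nonzerodivisor as
    soon as it is nonzero. *)
Lemma linear_regular (r s : seq R) :
    (forall f, f \in r ++ s -> is_linear_form f) ->
    (forall i, (i < size s)%N -> exists p : 'I_N -> k,
       [/\ forall f, f \in r -> f.@[p] = 0,
           forall j, (j < i)%N -> (s`_j).@[p] = 0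
         & (s`_i).@[p] != 0]) ->
  weakly_regular (adjoins zero_ideal r) s.
Proof.
move=> lin_rs points; apply/weakly_regularP => i lt_i g.
have [p [r0 s0 si_neq0]] := points i lt_i.
rewrite /adjoins -foldl_cat -/(adjoins _ _).
have [|_ _ prime_i] := @linear_prime (r ++ take i s).
  move=> f fi; apply: lin_rs; move: fi; rewrite !mem_cat.
  by case/orP=> [->//|/mem_take->]; rewrite orbT.
case/prime_i => // si; case/eqP: si_neq0.
have iker : is_ideal (fun f : R => f.@[p] = 0).
  split=> [|x y|a x]; first exact: meval0.
    by rewrite mevalD => -> ->; rewrite addr0.
  by rewrite mevalM => ->; rewrite mulr0.
apply: (adjoins_min iker _ _ si) => [_ ->|f]; first exact: meval0.
rewrite mem_cat => /orP[/r0 //|/(nthP 0)[j]].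
rewrite size_takel ?(ltnW lt_i) // => lt_j <-; rewrite nth_take //; exact: s0.
Qed.

(** * Prime ideals generated by variables *)

Definition var_ideal S : R -> Prop :=
  adjoins zero_ideal [seq 'X_v | v <- enum S].

Lemma var_ideal_prime S : is_prime (var_ideal S).
Proof.
apply: linear_prime => _ /mapP[v _ ->].
by exists (fun w => (w == v)%:R); apply: linear_form_delta.
Qed.

Lemma var_ideal_ideal S : is_ideal (var_ideal S).
Proof. by have [] := var_ideal_prime S. Qed.

Lemma var_ideal_var S v : v \in S -> var_ideal S 'X_v.
Proof.
move=> Sv; apply: mem_adjoins; first exact: zero_ideal_ideal.
by apply: map_f; rewrite mem_enum.
Qed.

Lemma var_ideal_min J S :
  is_ideal J -> (forall v, v \in S -> J 'X_v) -> sub_ideal (var_ideal S) J.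
Proof.
move=> iJ JS; apply: adjoins_min => //; first exact: sub_zero_ideal.
by move=> _ /mapP[v Sv ->]; apply: JS; rewrite -mem_enum.
Qed.

Lemma var_idealP S f :
  var_ideal S f <->
  (forall m, m \in msupp f -> exists2 v, v \in S & (0 < m v)%N).
Proof.
split=> [|supp_f].
  move: f; apply: adjoins_min => [||_ /mapP[v Sv ->] m].
  - split=> [m|f g Sf Sg m|a f Sf m]; first by rewrite msupp0.
      by move/msuppD_le; rewrite mem_cat => /orP[/Sf|/Sg].
    case/msuppM_le/allpairsP=> -[m1 m2] /= [_ /Sf[v Sv v_gt0] ->].
    by exists v => //; rewrite mnmDE ltn_addl.
  - by move=> _ -> m; rewrite msupp0.
  rewrite msuppX inE => /eqP->; exists v; first by rewrite -mem_enum.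
  by rewrite mnm1E eqxx.
have iS := var_ideal_ideal S; rewrite [f]mpolyE big_seq.
apply: ideal_sum => // m /supp_f[v Sv v_gt0]; apply: ideal_scale => //.
have /submK<- : (U_(v) <= m)%MM.
  by apply/mnm_lepP => w; rewrite mnm1E; case: eqP => // <-; exact: v_gt0.
by rewrite mpolyXD; apply: ideal_mull => //; apply: var_ideal_var.
Qed.

Lemma var_ideal_varE S v : var_ideal S 'X_v <-> v \in S.
Proof.
split=> [/var_idealP|]; last exact: var_ideal_var.
case/(_ U_(v)%MM); first by rewrite msuppX mem_head.
by move=> w Sw; rewrite mnm1E; case: eqP => // ->.
Qed.

Lemma sub_var_ideal S T : sub_ideal (var_ideal S) (var_ideal T) <-> S \subset T.
Proof.
split=> [ST|/subsetP ST].
  by apply/subsetP => v Sv; apply/var_ideal_varE/ST/var_ideal_var.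
by apply: var_ideal_min => [|v /ST]; [apply: var_ideal_ideal|apply: var_ideal_var].
Qed.

Lemma var_idealU S T :
  ideal_add (var_ideal S) (var_ideal T) = var_ideal (S :|: T).
Proof.
have iS := var_ideal_ideal S; have iT := var_ideal_ideal T.
apply: eq_idealP => f; split; move: f.
  apply: ideal_add_min; first exact: var_ideal_ideal.
    exact/sub_var_ideal/subsetUl.
  exact/sub_var_ideal/subsetUr.
apply: var_ideal_min; first exact: ideal_add_ideal.
move=> v; rewrite inE => /orP[Sv|Tv].
  by apply: ideal_addl => //; apply: var_ideal_var.
by apply: ideal_addr => //; apply: var_ideal_var.
Qed.

End LinearIdeals.

Arguments var_ideal k {N} S _.

(** * Krull dimension of a polynomial ring *)

Section KrullDimension.

Variables (k : fieldType) (N : nat).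
Local Open Scope ring_scope.

Local Notation R := {mpoly k[N]}.

Implicit Types (P Q : R -> Prop) (f g : R) (ch : nat -> R -> Prop).

Definition independent_mod P (T : finType) (w : T -> R) : Prop :=
  forall c : T -> k, P (\sum_i c i *: w i) -> forall i, c i = 0.

(** An f in Q but not in P is transcendental over anything independent modulo
    Q: dividing a relation modulo P by the largest power of f leaves a relation
    whose constant term lies in Q. *)
Lemma independent_powers P Q (T : finType) (w : T -> R) f :
    is_prime P -> is_ideal Q -> sub_ideal P Q -> Q f -> ~ P f ->
    independent_mod Q w ->
  forall n (c : nat -> T -> k),
    P (\sum_(l < n) f ^+ l * \sum_i c l i *: w i) ->
  forall l, (l < n)%N -> forall i, c l i = 0.
Proof.
move=> [iP _ primeP] iQ PQ Qf nPf w_indep; elim=> [//|n IHn] c.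
rewrite big_ord_recl expr0 mul1r /=.
under [X in _ + X]eq_bigr do rewrite /bump leq0n add1n exprS -mulrA.
rewrite -mulr_sumr; set g := \sum_(l < n) _ => Pc.
have c0 i : c 0%N i = 0.
  move: i; apply: w_indep; rewrite -[X in Q X](addrK (f * g)).
  by apply: ideal_minus; [|exact: PQ|exact: ideal_mulr].
move: Pc; rewrite big1 ?add0r => [|i _]; last by rewrite c0 scale0r.
by case/primeP=> // /(IHn (fun l => c l.+1)) cS0 [|l] // lt_l; apply: cS0.
Qed.

(** Choosing an element of each step of the chain outside the previous prime, its
    powers up to the M-th multiply the number of independent elements by M + 1,
    at the price of a degree linear in M. *)
Lemma chain_independent ch d :
    prime_chain ch d ->
  exists D, forall M, exists (T : finType) (w : T -> R),
    [/\ #|T| = (M.+1 ^ d)%N, forall i, (msize (w i) <= D * M + 1)%N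
      & independent_mod (ch 0%N) w].
Proof.
elim: d ch => [|d IHd] ch [ch_prime ch_lt].
  exists 0%N => M; exists unit, (fun=> 1); split=> [|_|c].
  - by rewrite card_unit.
  - by rewrite msize1.
  have [iP P1 _] := ch_prime 0%N isT.
  rewrite (bigD1 tt) //= big1 => [|[] //]; rewrite addr0 => Pc [].
  apply/eqP/negP => /negP c_neq0; apply: P1.
  by rewrite -[1](scalerK c_neq0); apply: ideal_scale.
have [|D D_indep] := IHd (fun i => ch i.+1).
  by split=> i le_i; [apply: ch_prime|apply: ch_lt].
have [sub01 nsub01] := ch_lt 0%N isT.
have [f nf] := not_all_ex_not _ _ nsub01.
have [f1 f0] : ch 1%N f /\ ~ ch 0%N f by apply: imply_to_and.
exists (D + msize f)%N => M; have [T [w [cardT size_w w_indep]]] := D_indep M.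
exists (T * 'I_M.+1)%type, (fun il : T * 'I_M.+1 => f ^+ il.2 * w il.1); split.
- by rewrite card_prod card_ord cardT expnS mulnC.
- case=> i l /=; have le_l : (l <= M)%N by rewrite -ltnS.
  have szX n : (msize (f ^+ n) <= n * msize f + 1)%N.
    elim: n => [|n IHn]; first by rewrite expr0 msize1.
    have [-> | f_neq0] := eqVneq f 0; first by rewrite expr0n /= msize0.
    rewrite exprS msizeM ?expf_neq0 // mulSn.
    move: IHn; move: (msize f) (msize _) => a b; lia.
  have [-> | w_neq0] := eqVneq (w i) 0; first by rewrite mulr0 msize0.
  have [-> | f_neq0] := eqVneq (f ^+ l) 0; first by rewrite mul0r msize0.
  rewrite msizeM //; have := size_w i; have := szX l.
  have : (l * msize f <= M * msize f)%N by rewrite leq_mul2r le_l orbT.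
  rewrite mulnDl [(msize f * M)%N]mulnC.
  by move: (msize f) (msize (w i)) (msize (f ^+ l)) => a b b'; lia.
have iQ : is_ideal (ch 1%N) by have [] := ch_prime 1%N isT.
move=> c Pc [i l].
rewrite -[l]inord_val.
apply: (independent_powers (ch_prime 0%N isT) iQ sub01 f1 f0 w_indep
          (n := M.+1) (c := fun l i => c (i, inord l))) => //.
congr (ch 0%N): Pc.
rewrite (eq_bigr (fun il => c (il.1, il.2) *: (f ^+ il.2 * w il.1))); last by case.
rewrite -(pair_bigA _ (fun i l => c (i, l) *: (f ^+ l * w i))) /= exchange_big /=.
apply: eq_bigr => j _; rewrite mulr_sumr; apply: eq_bigr => x _.
by rewrite inord_val scalerAr.
Qed.

(** A polynomial of degree at most B only involves monomials from a box with
    (B + 1)^N elements, which bounds the rank of the coefficient matrix. *)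
Lemma independent_card P (T : finType) (w : T -> R) B :
    is_ideal P -> independent_mod P w -> (forall i, (msize (w i) <= B.+1)%N) ->
  (#|T| <= B.+1 ^ N)%N.
Proof.
move=> iP w_indep size_w.
pose J := {ffun 'I_N -> 'I_B.+1}.
have <- : #|J| = (B.+1 ^ N)%N by rewrite card_ffun !card_ord.
rewrite leqNgt; apply/negP => lt_JT.
pose mon (j : J) := [multinom (j i : nat) | i < N]%MM.
pose A := \matrix_(i < #|T|, j < #|J|) (w (enum_val i))@_(mon (enum_val j)).
have : kermx A != 0.
  by rewrite kermx_eq0 /row_free neq_ltn (leq_ltn_trans (rank_leq_col A)).
case/rowV0Pn=> v /sub_kermxP vA0 v_neq0.
case/eqP: v_neq0; apply/rowP => i; rewrite mxE.
rewrite -[i]enum_valK; move: (enum_val i) => {}i.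
apply: (w_indep (fun i => v 0 (enum_rank i))).
suff -> : \sum_i v 0 (enum_rank i) *: w i = 0 by apply: ideal_zero.
apply/mpolyP => m; rewrite mcoeff0 raddf_sum /=.
have [lt_m|le_m] := ltnP (mdeg m) B.+1; last first.
  rewrite big1 // => x _; rewrite mcoeffZ memN_msupp_eq0 ?mulr0 //.
  by apply: msize_mdeg_ge; apply: leq_trans le_m.
have lt_mi x : (m x < B.+1)%N.
  by apply: leq_ltn_trans lt_m; rewrite mdegE (bigD1 x) //= leq_addr.
pose j : J := [ffun x => Ordinal (lt_mi x)].
have mE : m = mon j by apply/mnmP => x; rewrite mnmE ffunE.
have := congr1 (fun B : 'rV_ _ => B 0 (enum_rank j)) vA0.
rewrite !mxE => vAj0; rewrite -[RHS]vAj0 [RHS](reindex_onto enum_rank enum_val) /=.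
  apply: eq_big => [x|x _]; first by rewrite enum_rankK eqxx.
  by rewrite mcoeffZ !mxE !enum_rankK -mE.
by move=> x _; rewrite enum_valK.
Qed.

(** For d > N the (M + 1)^d independent elements outgrow the (DM + 1)^N monomials
    available to them. *)
Lemma prime_chain_leq ch d : prime_chain ch d -> (d <= N)%N.
Proof.
move=> ch_d; have [D D_indep] := chain_independent ch_d.
have [ch_prime _] := ch_d; have [iP _ _] := ch_prime 0%N isT.
(* (DM + 1)^N <= (D + 1)^N (M + 1)^N < (M + 1)^(N + 1) as soon as M >= (D + 1)^N *)
pose M := (D.+1 ^ N)%N; have [T [w [cardT size_w w_indep]]] := D_indep M.
have : (M.+1 ^ d <= (D * M).+1 ^ N)%N.
  by rewrite -cardT; apply: (independent_card iP w_indep) => i; rewrite -addn1; apply: size_w.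
rewrite [(d <= N)%N]leqNgt; apply: contraL => lt_Nd; rewrite -ltnNge.
apply: (@leq_trans (M.+1 ^ N.+1)); last exact: leq_pexp2l.
apply: (@leq_ltn_trans (M * M.+1 ^ N)).
  rewrite {2}/M -expnMn; have [->|N_gt0] := posnP N; first by rewrite !expn0.
  by rewrite leq_exp2r //; lia.
by rewrite expnS ltn_pmul2r ?expn_gt0.
Qed.

(** * Chains and heights of prime ideals generated by variables *)

Lemma chain_cat ch d ch' d' :
    prime_chain ch d -> prime_chain ch' d' -> sub_ideal (ch d) (ch' 0%N) ->
  prime_chain (fun i => if (i < d)%N then ch i else ch' (i - d)%N) (d + d').
Proof.
move=> [ch_prime ch_lt] [ch'_prime ch'_lt] dd'; split=> i le_i.
  by case: ltnP => [/ltnW|le_di]; [apply: ch_prime|apply: ch'_prime; lia].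
case: (ltnP i d) => [lt_id|le_di]; last first.
  by rewrite ltnNge leqW // subSn //=; apply: ch'_lt; lia.
have [sub_i nsub_i] := ch_lt i lt_id.
case: ltnP => [//|le_d]; have ed : i.+1 = d by lia.
move: dd'; rewrite -ed subnn => dd'.
split=> [x /sub_i /dd' //|sub'_i]; apply: nsub_i => x /dd'; exact: sub'_i.
Qed.

Implicit Types (S T : {set 'I_N}).

Lemma var_ideal_chain S T :
    S \subset T ->
  exists ch, [/\ prime_chain ch (#|T| - #|S|), ch 0%N = var_ideal k S
               & ch (#|T| - #|S|)%N = var_ideal k T].
Proof.
move: {-2}(_ - _)%N (erefl (#|T| - #|S|)%N) => d.
elim: d T => [|d IHd] T cardT sST.
  have -> : T = S.
    by apply/eqP; rewrite eq_sym eqEcard sST /= -subn_eq0 cardT.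
  exists (fun=> var_ideal k S); split=> //; split=> // i _.
  exact: var_ideal_prime.
have [v Tv nSv] : exists2 v, v \in T & v \notin S.
  apply/subsetPn; apply: contraPN cardT => sTS.
  have /eqP-> : T == S by rewrite eqEsubset sTS.
  by rewrite subnn.
have := cardsD1 v T; rewrite Tv => cardT1.
have [||ch [[ch_prime ch_lt] ch0 chd]] := IHd (T :\ v).
- by move: cardT; rewrite cardT1 => /eqP; lia.
- by rewrite subsetD1 sST.
exists (fun i => if i == d.+1 then var_ideal k T else ch i); split=> //.
  split=> i; case: eqP => [->|neq_i] le_i; try exact: var_ideal_prime.
  - by apply: ch_prime; lia.
  - by lia.
  rewrite eqSS; case: eqP => [->|neq_id]; last by apply: ch_lt; lia.
  rewrite chd; split; first exact/sub_var_ideal/subD1set.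
  by move/sub_var_ideal/subsetP/(_ v Tv); rewrite !inE eqxx.
by rewrite eqxx.
Qed.

(** A chain below the ideal can be continued by adding the remaining N - #|S|
    variables one by one, and then has length at most N. *)
Lemma var_ideal_height S : is_prime_height (var_ideal k S) #|S|.
Proof.
split=> [|e [ch [ch_e chE]]].
  have [ch [ch_prime _ chE]] := var_ideal_chain (sub0set S).
  by exists ch; rewrite cards0 subn0 in ch_prime chE *.
have [ch' [ch'_prime ch'0 _]] := var_ideal_chain (subsetT S).
have sub_e : sub_ideal (ch e) (ch' 0%N) by rewrite chE ch'0.
have := prime_chain_leq (chain_cat ch_e ch'_prime sub_e).
rewrite cardsT card_ord.
have := max_card (mem S); rewrite card_ord; lia.
Qed.

Lemma chain_over_var_ideal S ch d :
    prime_chain ch d -> sub_ideal (var_ideal k S) (ch 0%N) ->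
  exists ch', prime_chain ch' (#|S| + d) /\ ch' (#|S| + d)%N = ch d.
Proof.
move=> ch_d Sch.
have [ch' [ch'_prime _ ch'E]] := var_ideal_chain (sub0set S).
rewrite cards0 subn0 in ch'_prime ch'E.
exists (fun i => if (i < #|S|)%N then ch' i else ch (i - #|S|)%N); split.
  by apply: chain_cat; rewrite ?ch'E.
by rewrite ltnNge leq_addr addKn.
Qed.

Lemma height_over_var_ideal S P h :
  is_prime P -> sub_ideal (var_ideal k S) P -> is_prime_height P h -> (#|S| <= h)%N.
Proof.
move=> primeP SP [_]; apply.
have [|ch] := @chain_over_var_ideal S (fun=> P) 0 _ SP; first by split.
by rewrite addn0; exists ch.
Qed.

Lemma is_height_var_ideal S : is_height (var_ideal k S) #|S|.
Proof.
split=> [|h [P [primeP SP]]]; last exact: height_over_var_ideal.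
exists (var_ideal k S); split=> //; last exact: var_ideal_height.
exact: var_ideal_prime.
Qed.

Lemma is_height_uniq (I : R -> Prop) h h' : is_height I h -> is_height I h' -> h = h'.
Proof. by move=> [? hmin] [? h'min]; apply/eqP; rewrite eqn_leq hmin ?h'min. Qed.

End KrullDimension.

(** * Koszul cochains and the upper bound on depth *)

Section Koszul.

Variables (R : comNzRingType) (N : nat) (x : 'I_N -> R).
Local Open Scope ring_scope.

Implicit Types (A D : {set 'I_N}) (v w : 'I_N) (c z b : {set 'I_N} -> R)
  (I : R -> Prop).

Definition wedge_sign v A : R := (-1) ^+ #|[set u in A | (u < v)%N]|.

Definition wedge v c : {set 'I_N} -> R :=
  fun A => if v \in A then wedge_sign v A * c (A :\ v) else 0.

Definition contract v c : {set 'I_N} -> R :=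
  fun A => if v \in A then 0 else wedge_sign v A * c (v |: A).

Lemma wedge_in v c A : v \in A -> wedge v c A = wedge_sign v A * c (A :\ v).
Proof. by rewrite /wedge => ->. Qed.

Lemma wedge_out v c A : v \notin A -> wedge v c A = 0.
Proof. by rewrite /wedge => /negbTE ->. Qed.

(** Multiplication by the sum of [x v] e_v over [v] in [D]; the full Koszul
    differential is the case [D = setT]. *)
Definition koszul_diff D c : {set 'I_N} -> R :=
  fun A => \sum_(v in D) x v * wedge v c A.

Lemma wedge_signD1 v w A :
  w \in A -> wedge_sign v (A :\ w) = (-1) ^+ (w < v)%N * wedge_sign v A.
Proof.
move=> Aw; rewrite /wedge_sign.
have -> : [set u in A :\ w | (u < v)%N] = [set u in A | (u < v)%N] :\ w.
  by apply/setP => u; rewrite !inE andbA.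
by rewrite [in RHS](cardsD1 w) !inE Aw /= exprD signrMK.
Qed.

Lemma wedge_signU1 v w A :
  w \notin A -> wedge_sign v (w |: A) = (-1) ^+ (w < v)%N * wedge_sign v A.
Proof.
move=> nAw; rewrite -[in RHS](setU1K nAw) wedge_signD1 ?setU11 //.
by rewrite signrMK.
Qed.

Lemma wedge_sign2 v A y : wedge_sign v A * (wedge_sign v A * y) = y.
Proof. exact: signrMK. Qed.

(** Of two distinct indices exactly one precedes the other. *)
Lemma wedge_sign_lt v w :
  v != w -> (-1) ^+ (v < w)%N = - (-1) ^+ (w < v)%N :> R.
Proof.
move=> neq_vw; have := neq_vw; rewrite -val_eqE /= neq_ltn.
by case: ltngtP => //= _ _; rewrite ?opprK.
Qed.

Lemma wedgeC v w c A : v != w -> wedge v (wedge w c) A = - wedge w (wedge v c) A.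
Proof.
move=> neq_vw; rewrite /wedge !inE [w == v]eq_sym neq_vw /=.
case Av: (v \in A); case Aw: (w \in A); rewrite ?mulr0 ?oppr0 //.
rewrite !wedge_signD1 // setDDl setUC -setDDl (wedge_sign_lt neq_vw).
by ring.
Qed.

Lemma wedge_wedge v c A : wedge v (wedge v c) A = 0.
Proof. by rewrite /wedge !inE eqxx; case: ifP; rewrite ?mulr0. Qed.

Lemma wedge_contract v w c A :
  wedge v (contract w c) A + contract w (wedge v c) A = (v == w)%:R * c A.
Proof.
rewrite /wedge /contract !inE [w == v]eq_sym; have [<-|neq_vw] /= := eqVneq v w.
  rewrite mul1r; case Av: (v \in A).
    by rewrite addr0 setD1K // wedge_signD1 // ltnn expr0 mul1r wedge_sign2.
  by rewrite add0r setU1K ?Av // wedge_signU1 ?Av // ltnn expr0 mul1r wedge_sign2.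
rewrite mul0r; case Av: (v \in A); case Aw: (w \in A);
  rewrite ?mulr0 ?addr0 ?mul0r //.
rewrite wedge_signD1 // wedge_signU1 ?Aw // (wedge_sign_lt neq_vw).
have -> : (w |: A) :\ v = w |: A :\ v.
  apply/setP => u; rewrite !inE; case: (eqVneq u w) => [->|_] //=.
  by rewrite eq_sym neq_vw.
by ring.
Qed.

Lemma koszul_diff_diff D c A : koszul_diff D (koszul_diff D c) A = 0.
Proof.
pose F v w := x v * x w * wedge v (wedge w c) A.
have -> : koszul_diff D (koszul_diff D c) A = \sum_(v in D) \sum_(w in D) F v w.
  apply: eq_bigr => v _; have [Av|nAv] := boolP (v \in A).
    rewrite wedge_in // !mulr_sumr; apply: eq_bigr => w _.
    by rewrite /F (wedge_in _ Av); ring.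
  by rewrite wedge_out // mulr0 big1 // => w _; rewrite /F wedge_out // mulr0.
have FC v w : v != w -> F v w = - F w v.
  by move=> neq_vw; rewrite /F (wedgeC _ _ neq_vw); ring.
have Fvv v : F v v = 0 by rewrite /F wedge_wedge mulr0.
have splitF v : \sum_(w in D) F v w =
    \sum_(w in D | (w < v)%N) F v w + \sum_(w in D | (v < w)%N) F v w.
  rewrite (bigID (fun w : 'I_N => (w < v)%N)) /=; congr (_ + _).
  rewrite (bigID (fun w : 'I_N => (v < w)%N)) /= [X in _ + X]big1 ?addr0.
    by apply: eq_bigl => w; case: ltngtP; rewrite ?andbT ?andbF.
  move=> w /andP[/andP[_ le_vw] le_wv].
  suff -> : w = v by exact: Fvv.
  by apply: val_inj => /=; lia.
rewrite (eq_bigr _ (fun v _ => splitF v)) big_split /=.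
have -> : \sum_(v in D) \sum_(w in D | (v < w)%N) F v w =
    \sum_(v in D) \sum_(w in D | (w < v)%N) F w v.
  rewrite (exchange_big_dep (fun v => v \in D)) /=; last by move=> v w _ /andP[].
  by apply: eq_bigr => v Dv; apply: eq_bigl => w; rewrite Dv.
rewrite -big_split big1 // => v Dv; rewrite -big_split big1 //= => w /andP[_ lt_wv].
by rewrite FC ?addNr // -val_eqE /= neq_ltn lt_wv orbT.
Qed.

Lemma koszul_diffB D c c' A :
  koszul_diff D (fun B => c B - c' B) A = koszul_diff D c A - koszul_diff D c' A.
Proof.
rewrite -sumrB; apply: eq_bigr => v _; rewrite /wedge.
by case: ifP => _; ring.
Qed.

Lemma koszul_diffMr D c y A :
  koszul_diff D (fun B => c B * y) A = koszul_diff D c A * y.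
Proof.
rewrite mulr_suml; apply: eq_bigr => v _; rewrite /wedge.
by case: ifP => _; ring.
Qed.

Lemma koszul_diff_mod I D c A :
  is_ideal I -> (forall B, I (c B)) -> I (koszul_diff D c A).
Proof.
move=> iI Ic; apply: ideal_sum => // v _; apply: ideal_mull => //.
by rewrite /wedge; case: ifP => _; [apply: ideal_mull|apply: ideal_zero].
Qed.

(** Multiplication by an element of the ideal (x_0, ..., x_(N-1)) is
    null-homotopic on the Koszul complex. *)
Lemma koszul_homotopy (g : 'I_N -> R) z A :
  (\sum_w g w * x w) * z A =
  koszul_diff setT (fun B => \sum_w g w * contract w z B) A
  + \sum_w g w * contract w (koszul_diff setT z) A.
Proof.
have -> : koszul_diff setT (fun B => \sum_w g w * contract w z B) A =
    \sum_w \sum_v g w * (x v * wedge v (contract w z) A).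
  rewrite exchange_big; apply: eq_big => [v|v _]; first by rewrite inE.
  have [Av|nAv] := boolP (v \in A).
    rewrite wedge_in // !mulr_sumr; apply: eq_bigr => w _.
    by rewrite wedge_in //; ring.
  by rewrite wedge_out // mulr0 big1 // => w _; rewrite wedge_out // !mulr0.
have -> : \sum_w g w * contract w (koszul_diff setT z) A =
    \sum_w \sum_v g w * (x v * contract w (wedge v z) A).
  apply: eq_bigr => w _; rewrite -mulr_sumr; congr (_ * _).
  rewrite {1}/contract; case Aw: (w \in A).
    by rewrite big1 // => v _; rewrite /contract Aw mulr0.
  rewrite mulr_sumr; apply: eq_big => [v|v _]; first by rewrite inE.
  by rewrite /contract Aw; ring.
rewrite mulr_suml -big_split; apply: eq_bigr => w _ /=.
rewrite -big_split (bigD1 w) //= big1 => [|v neq_vw].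
  by rewrite addr0 -!mulrDr wedge_contract eqxx mul1r mulrA.
by rewrite -!mulrDr wedge_contract (negPf neq_vw) mul0r !mulr0.
Qed.

(** The Koszul cohomology of R/I vanishes below the length of a regular
    sequence in (x_0, ..., x_(N-1)): if f z is a coboundary d h modulo I, then h
    is a cocycle modulo I + (f), hence by induction a coboundary there, say
    h = d b' + f b'', and f z = f d b'' allows f to be cancelled. *)
Lemma koszul_acyclic n I (fs : seq R) z :
    is_ideal I -> weakly_regular I fs ->
    (forall f, f \in fs -> exists g, f = \sum_w g w * x w) ->
    (n <= size fs)%N -> (forall A, (n <= #|A|)%N -> z A = 0) ->
    (forall A, I (koszul_diff setT z A)) ->
  exists b, forall A, I (z A - koszul_diff setT b A).
Proof.
elim: n I fs z => [|n IHn] I fs z iI.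
  move=> _ _ _ z0 _; exists (fun=> 0) => A; rewrite z0 // sub0r.
  by apply: ideal_opp => //; apply: koszul_diff_mod => // B; apply: ideal_zero.
case: fs => // f fs [reg_f reg_fs] fs_x le_n z0 Idz.
have [|g fE] := fs_x f; first exact: mem_head.
pose h B := \sum_w g w * contract w z B.
have fzE A : I (f * z A - koszul_diff setT h A).
  rewrite fE koszul_homotopy addrC addKr; apply: ideal_sum => // w _.
  apply: ideal_mull => //; rewrite /contract.
  by case: ifP => _; [apply: ideal_zero|apply: ideal_mull].
have iIf := adjoin_ideal f iI.
have [||||b' hE] := IHn _ fs h iIf reg_fs.
- by move=> f' fs'; apply: fs_x; rewrite inE fs' orbT.
- exact: le_n.
- move=> A le_A; rewrite /h big1 // => w _; rewrite /contract.
  case: ifP => [|/negbT nAw]; first by rewrite mulr0.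
  by rewrite z0 ?mulr0 // cardsU1 nAw add1n.
- move=> A; apply: (@ideal_congr _ _ _ (f * z A)) => //.
    by rewrite -opprB; apply: ideal_opp => //; apply: sub_adjoin.
  by apply: ideal_mulr => //; apply: mem_adjoin.
have /fin_all_exists[y /fin_all_exists[b yb]] : forall A, exists y a,
  I y /\ h A - koszul_diff setT b' A = y + a * f by exact: hE.
exists b => A; apply: reg_f.
apply: (@ideal_congr _ _ _ (koszul_diff setT y A)) => //; last first.
  by apply: koszul_diff_mod => // B; have [] := yb B.
have -> : koszul_diff setT y A = koszul_diff setT h A - koszul_diff setT b A * f.
  rewrite -[koszul_diff setT h A]subr0 -(koszul_diff_diff setT b' A).
  rewrite -koszul_diffMr -!koszul_diffB.
  apply: eq_bigr => v _; rewrite /wedge; case: ifP => // _.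
  by have [_ ->] := yb (A :\ v); rewrite addrK.
by rewrite mulrBr opprB addrA [f * koszul_diff _ _ _]mulrC subrK; apply: fzE.
Qed.

End Koszul.
Section DepthUpperBound.

Variables (k : fieldType) (N : nat).
Local Open Scope ring_scope.

Local Notation R := {mpoly k[N]}.

Implicit Types (I : R -> Prop) (f : R) (X Y : {set 'I_N}) (s : seq R).

Lemma mcoeffXM (v w : 'I_N) f : ('X_w * f)@_U_(v) = (w == v)%:R * f@_0%MM.
Proof.
have [<-|neq_wv] := eqVneq w v.
  by rewrite mul1r mulrC -[X in _@_X](addm0 U_(w)%MM) mcoeffMX.
rewrite mul0r; apply: memN_msupp_eq0; rewrite mulrC (perm_mem (msuppMX f U_(w)%MM)).
apply/mapP => -[m _ /mnmP/(_ w)]; rewrite mnmDE !mnm1E eqxx.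
by rewrite eq_sym (negPf neq_wv).
Qed.

Lemma irrelevant_span f :
  f@_0%MM = 0 -> exists g : 'I_N -> R, f = \sum_w g w * 'X_w.
Proof.
move=> f0; have : var_ideal k setT f.
  apply/var_idealP => m; rewrite mcoeff_msupp => fm.
  have : m != 0%MM by apply: contraNneq fm => ->; rewrite f0.
  rewrite -mdeg_eq0 mdegE sum_nat_eq0 negb_forall => /existsP[v].
  by rewrite -lt0n; exists v.
apply: (var_ideal_min (J := fun h : R => exists g : 'I_N -> R,
  h = \sum_w g w * 'X_w)) => [|v _].
  split=> [|_ _ [g ->] [h ->]|a _ [g ->]].
  - by exists (fun=> 0); rewrite big1 // => w _; rewrite mul0r.
  - by exists (fun w => g w + h w); rewrite -big_split; apply: eq_bigr => w _;
       rewrite mulrDl.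
  - by exists (fun w => a * g w); rewrite mulr_sumr; apply: eq_bigr => w _;
       rewrite mulrA.
exists (fun w => (w == v)%:R); rewrite (bigD1 v) //= eqxx mul1r big1 ?addr0 //.
by move=> w /negPf->; rewrite mul0r.
Qed.

(** Let T be the set of the variables outside X and Y.  The sum of x_v e_v over v
    in Y, wedged with the top form of T, is a cocycle modulo I, because all
    products of X with Y lie in I.  (If I = J cap K with J + K = (X, Y), Y in J
    and X in K, it is the image of 1 under the connecting map of
    0 -> R/I -> R/J (+) R/K -> R/(X, Y) -> 0, spread over T.)  It is not a
    coboundary: as I has no linear terms, comparing coefficients of x_v in the
    component indexed by T and v forces the component b(T) of a primitive b to
    have constant term 1 for v in Y, but 0 for v in X. *)
Lemma regular_size_leq I X Y s :
    is_ideal I -> (forall f v, I f -> f@_U_(v) = 0) ->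
    [disjoint X & Y] -> X != set0 -> Y != set0 ->
    (forall v w, v \in X -> w \in Y -> I ('X_v * 'X_w)) ->
    weakly_regular I s -> (forall f, f \in s -> f@_0%MM = 0) ->
  (size s <= #|~: (X :|: Y)|.+1)%N.
Proof.
move=> iI I1 dXY /set0Pn[u Xu] /set0Pn[w Yw] IXY reg_s s0.
rewrite leqNgt; apply/negP => lt_s.
set T := ~: (X :|: Y) in lt_s.
pose x v : R := 'X_v; pose top (A : {set 'I_N}) : R := (A == T)%:R.
pose z : {set 'I_N} -> R := koszul_diff x Y top.
have nTX v : v \in X -> v \notin T by rewrite !inE => ->.
have nTY v : v \in Y -> v \notin T by rewrite !inE => ->; rewrite orbT.
have topT v A : v \in T -> wedge v top A = 0.
  move=> Tv; rewrite /wedge; case: ifP => // _; rewrite /top.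
  by case: eqP => [AT|_]; rewrite ?mulr0 //; move: Tv; rewrite -AT !inE eqxx.
have z_large (A : {set 'I_N}) : (#|T|.+2 <= #|A|)%N -> z A = 0.
  move=> le_A; rewrite /z /koszul_diff big1 // => v _; rewrite /wedge.
  case: ifP => [Av|_]; rewrite ?mulr0 // /top.
  case: eqP => [AT|_]; rewrite ?mulr0 //.
  by move: le_A; rewrite (cardsD1 v A) Av AT; lia.
have z_cocycle (A : {set 'I_N}) : I (koszul_diff x setT z A).
  have -> : koszul_diff x setT z A =
      koszul_diff x X z A + koszul_diff x Y z A + koszul_diff x T z A.
    rewrite /koszul_diff.
    rewrite (bigID (fun v => v \in X :|: Y)) /=; congr (_ + _); last first.
      by apply: eq_bigl => v; rewrite !inE.
    by rewrite -bigU //=; apply: eq_bigl => v; rewrite !inE.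
  have -> : koszul_diff x Y z A = 0 by apply: koszul_diff_diff.
  rewrite addr0.
  have -> : koszul_diff x T z A = 0.
    rewrite /koszul_diff big1 // => v Tv.
    suff -> : wedge v z A = 0 by rewrite mulr0.
    have [Av|nAv] := boolP (v \in A); last by rewrite wedge_out.
    rewrite wedge_in // /z /koszul_diff mulr_sumr big1 // => y Yy.
    rewrite mulrCA -(wedge_in _ Av) wedgeC; last first.
      by apply: contraTneq Tv => ->; apply: nTY.
    have [Ay|nAy] := boolP (y \in A); last by rewrite wedge_out // oppr0 mulr0.
    by rewrite wedge_in // topT // mulr0 oppr0 mulr0.
  rewrite addr0; apply: ideal_sum => // v Xv.
  have [Av|nAv] := boolP (v \in A); last by rewrite wedge_out // mulr0; apply: ideal_zero.
  rewrite wedge_in // mulrCA; apply: ideal_mull => //.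
  rewrite mulr_sumr; apply: ideal_sum => // y Yy.
  by rewrite mulrA; apply: ideal_mulr => //; apply: IXY.
have [b zb] := koszul_acyclic (x := x) iI reg_s
  (fun f fs => irrelevant_span (s0 f fs)) lt_s z_large z_cocycle.
have bT v : v \notin T -> (v \in Y)%:R = (b T)@_0%MM.
  move=> nTv; have := I1 _ v (zb (v |: T)).
  rewrite mcoeffB /z.
  have coefU (D : {set 'I_N}) (c : {set 'I_N} -> R) :
      (koszul_diff x D c (v |: T))@_U_(v) =
      (v \in D)%:R * ((-1) ^+ #|[set y in v |: T | (y < v)%N]| * (c T)@_0%MM).
    have -> : (-1) ^+ #|[set y in v |: T | (y < v)%N]| * (c T)@_0%MM =
        (wedge v c (v |: T))@_0%MM.
      by rewrite wedge_in ?setU11 // setU1K // rmorphM rmorph_sign.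
    rewrite /koszul_diff raddf_sum (eq_bigr _ (fun y _ => mcoeffXM v y _)) /=.
    have [Dv|nDv] := boolP (v \in D).
      rewrite (bigD1 v) //= eqxx big1 ?addr0 // => y /andP[_ /negPf->].
      by rewrite mul0r.
    by rewrite big1 ?mul0r // => y Dy; case: eqP nDv => [<-|]; rewrite ?Dy // mul0r.
  rewrite !coefU inE mul1r /top eqxx mcoeff1 eqxx mulr1.
  by rewrite mulrC -mulrBr => /eqP; rewrite mulf_eq0 signr_eq0 subr_eq0 => /eqP.
have := bT _ (nTY _ Yw); rewrite -(bT _ (nTX _ Xu)) Yw.
have -> : u \in Y = false by apply: disjointFr Xu.
by move/eqP; rewrite oner_eq0.
Qed.

End DepthUpperBound.

(** * Minimal vertex covers of an unmixed Ferrers graph *)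

Lemma card_ord_lt n p : p <= n -> #|[set i : 'I_n | i < p]| = p.
Proof.
move=> le_pn; rewrite -[RHS]card_ord.
have inj_widen : injective (widen_ord le_pn).
  by move=> i j /(congr1 val)/= /val_inj.
rewrite -(card_imset _ inj_widen).
apply: eq_card => i; rewrite !inE; apply/idP/imsetP => [lt_ip|[j _ ->]] //=.
by exists (Ordinal lt_ip) => //; apply: val_inj.
Qed.

Section FerrersCovers.

Variables (n m : nat) (la : n.-tuple nat).
Hypothesis la_gt0 : forall i : 'I_n, 0 < tnth la i.
Hypothesis la_head : nth 0 la 0 = m.
Hypothesis n_gt0 : 0 < n.
Hypothesis la_noninc : forall i j : 'I_n, i <= j -> tnth la j <= tnth la i.
Hypothesis G_unmixed : unmixed (@ferrers_graph n m la).

Local Notation graph := (@ferrers_graph n m la).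

Definition corner_set (p q : nat) : {set 'I_n + 'I_m} :=
  [set u : 'I_n + 'I_m | match u with inl i => i < p | inr j => j < q end].

Lemma card_corner_set p q : p <= n -> q <= m -> #|corner_set p q| = p + q.
Proof.
move=> le_pn le_qm.
have -> : corner_set p q =
    (@inl 'I_n 'I_m) @: [set i : 'I_n | i < p] :|: (@inr 'I_n 'I_m) @: [set j : 'I_m | j < q].
  apply/setP => -[i|j]; rewrite !inE.
    rewrite mem_imset ?inE; last by move=> ? ? [].
    by rewrite orbC (_ : _ \in _ = false) //; apply/imsetP => -[].
  rewrite [X in _ = _ || X]mem_imset ?inE; last by move=> ? ? [].
  by rewrite (_ : _ \in _ = false) //; apply/imsetP => -[].
rewrite cardsU (_ : _ :&: _ = set0) ?cards0 ?subn0; last first.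
  by apply/setP => u; rewrite !inE; apply/andP => -[/imsetP[i _ ->] /imsetP[]].
by rewrite !card_imset ?card_ord_lt //; move=> ? ? [].
Qed.

Lemma vertex_coverP (C : {set 'I_n + 'I_m}) :
  reflect (forall (i : 'I_n) (j : 'I_m), j < tnth la i -> (inl i \in C) || (inr j \in C))
          (vertex_cover graph C).
Proof.
apply: (iffP forallP) => [coverC i j lt_j|coverC u].
  by have /forallP/(_ (inr j))/implyP := coverC (inl i); apply.
apply/forallP => v; apply/implyP; case: u v => [i|j] [i'|j'] //= lt_j.
  exact: coverC.
by rewrite orbC; apply: coverC.
Qed.

Lemma nth_la (i : 'I_n) : nth 0 la i = tnth la i.
Proof. by rewrite (tnth_nth 0). Qed.

Lemma nth_la_noninc i j : i <= j -> nth 0 la j <= nth 0 la i.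
Proof.
move=> le_ij; have [lt_jn|le_nj] := ltnP j n; last first.
  by rewrite (nth_default 0 (n := j)) ?size_tuple.
have lt_in := leq_ltn_trans le_ij lt_jn.
by rewrite (nth_la (Ordinal lt_jn)) (nth_la (Ordinal lt_in)); apply: la_noninc.
Qed.

Lemma nth_la_le i : nth 0 la i <= m.
Proof. by rewrite -la_head; apply: nth_la_noninc. Qed.

Lemma corner_set_cover a : vertex_cover graph (corner_set a (nth 0 la a)).
Proof.
apply/vertex_coverP => i j lt_j; rewrite !inE; have [//|le_ai] := ltnP i a.
by apply: leq_trans lt_j _; rewrite -nth_la; apply: nth_la_noninc.
Qed.

(** Below the least vertex x_a outside C, all the x's are in C; the neighbours
    of x_a must then all be in C. *)
Lemma cover_sup_corner_set (C : {set 'I_n + 'I_m}) :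
    vertex_cover graph C ->
  exists2 a, a <= n & corner_set a (nth 0 la a) \subset C.
Proof.
move/vertex_coverP => coverC.
have exP : exists a, [forall i : 'I_n, (i == a :> nat) ==> (inl i \notin C)].
  by exists n; apply/forallP => i; rewrite ltn_eqF.
case: (ex_minnP exP) => a /forallP Ca a_min; exists a.
  by apply: a_min; apply/forallP => i; rewrite ltn_eqF.
apply/subsetP => -[i|j]; rewrite inE => lt_u.
  rewrite -[_ \in _]negbK; apply/negP => nCi.
  suff : a <= i by rewrite leqNgt lt_u.
  apply: a_min; apply/forallP => i'; apply/implyP => /eqP ii'.
  by rewrite (val_inj ii').
have lt_an : a < n.
  by rewrite ltnNge; apply/negP => le_na; rewrite nth_default ?size_tuple in lt_u.
have := Ca (Ordinal lt_an); rewrite eqxx /= => /negPf nCa.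
by have := coverC (Ordinal lt_an) j; rewrite -nth_la nCa; apply.
Qed.

Lemma minset_xs : minset (vertex_cover graph) (corner_set n 0).
Proof.
apply/minsetP; split.
  by have := corner_set_cover n; rewrite nth_default ?size_tuple.
move=> B /vertex_coverP coverB sB; apply/eqP; rewrite eqEsubset sB.
apply/subsetP => -[i _|j]; rewrite ?inE //.
have [j lt_j] : exists j : 'I_m, j < tnth la i.
  have m_gt0 : 0 < m by apply: leq_trans (la_gt0 i) _; rewrite -nth_la nth_la_le.
  by exists (Ordinal m_gt0).
case/orP: (coverB i j lt_j) => // /(subsetP sB).
by rewrite inE.
Qed.

Lemma minset_ys : minset (vertex_cover graph) (corner_set 0 m).
Proof.
apply/minsetP; split; first by have := corner_set_cover 0; rewrite la_head.
move=> B /vertex_coverP coverB sB; apply/eqP; rewrite eqEsubset sB.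
apply/subsetP => -[i|j _]; rewrite ?inE //.
have lt_j : j < tnth la (Ordinal n_gt0) by rewrite -nth_la la_head.
case/orP: (coverB _ j lt_j) => // /(subsetP sB).
by rewrite inE.
Qed.

Lemma ferrers_square : m = n.
Proof.
have := G_unmixed minset_xs minset_ys.
by rewrite !card_corner_set // addn0 add0n.
Qed.

Lemma card_minset_cover C : minset (vertex_cover graph) C -> #|C| = n.
Proof.
by move=> /G_unmixed/(_ minset_xs) ->; rewrite card_corner_set // addn0.
Qed.

End FerrersCovers.

Section SquareFerrers.

Variables (k : fieldType) (n : nat) (la : n.-tuple nat).
Hypothesis n_gt0 : 0 < n.
Hypothesis la_gt0 : forall i : 'I_n, 0 < tnth la i.
Hypothesis la_head : nth 0 la 0 = n.
Hypothesis la_noninc : forall i j : 'I_n, i <= j -> tnth la j <= tnth la i.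
Hypothesis G_unmixed : unmixed (@ferrers_graph n n la).

Local Notation graph := (@ferrers_graph n n la).
Local Notation I := (@ferrers_ideal n n la k).
Local Notation R := {mpoly k[n + n]}.

(** The a for which the first a of the x's and the first n - a of the y's form a
    minimal vertex cover. *)
Definition corner a := (a <= n) && (nth 0 la a == n - a).

Lemma corner_le a : corner a -> a <= n. Proof. by case/andP. Qed.

Lemma corner0 : corner 0. Proof. by rewrite /corner la_head subn0 eqxx. Qed.

Lemma corner_n : corner n.
Proof. by rewrite /corner leqnn subnn nth_default ?size_tuple. Qed.

Lemma corner_cover a : corner a -> vertex_cover graph (corner_set n n a (n - a)).
Proof. by case/andP=> _ /eqP <-; apply: corner_set_cover. Qed.

(** Unmixedness enters here: the size a + lambda_(a+1) of a minimal cover has to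
    be n. *)
Lemma cover_sup_corner (C : {set 'I_n + 'I_n}) :
    vertex_cover graph C ->
  exists2 a, corner a & corner_set n n a (n - a) \subset C.
Proof.
move=> coverC; have [B minB sBC] := minset_exists coverC.
have [a le_an sB] := cover_sup_corner_set (minsetp minB).
have BE := minsetinf minB (corner_set_cover n la_noninc a) sB.
have cardB := card_minset_cover la_gt0 la_head la_noninc G_unmixed minB.
have la_a : nth 0 la a = n - a.
  rewrite -BE card_corner_set // ?nth_la_le // in cardB.
  by apply/eqP; rewrite -(eqn_add2l a) cardB subnKC.
by exists a; rewrite /corner ?le_an -la_a ?BE ?eqxx.
Qed.

(** * The minimal primes of the edge ideal *)

Local Open Scope ring_scope.

Definition var_box p q : {set 'I_(n + n)} := [set v | split v \in corner_set n n p q].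

Definition corner_prime a : R -> Prop := var_ideal k (var_box a (n - a)).

Lemma mem_var_box u p q : (unsplit u \in var_box p q) = (u \in corner_set n n p q).
Proof. by rewrite inE unsplitK. Qed.

Lemma card_var_box p q : (p <= n)%N -> (q <= n)%N -> #|var_box p q| = (p + q)%N.
Proof.
move=> le_pn le_qn; rewrite -(card_corner_set le_pn le_qn).
rewrite -(card_imset _ (can_inj (@splitK n n))); apply: eq_card => u.
apply/imsetP/idP => [[v + ->]|Cu]; first by rewrite inE.
by exists (unsplit u); rewrite ?unsplitK // mem_var_box.
Qed.

Lemma var_boxU p q p' q' :
  var_box p q :|: var_box p' q' = var_box (maxn p p') (maxn q q').
Proof.
by apply/setP => v; rewrite !inE; case: (split v) => i; rewrite leq_max.
Qed.

Lemma ferrers_ideal_ideal : is_ideal I.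
Proof. exact: ideal_gen_ideal. Qed.

Lemma ferrers_ideal_edge (i j : 'I_n) :
  (j < tnth la i)%N -> I ('X_(lshift n i) * 'X_(rshift n j)).
Proof. by move=> lt_j J iJ; apply; exists i, j. Qed.

Lemma sub_corner_prime a : corner a -> sub_ideal I (corner_prime a).
Proof.
move=> /corner_cover/vertex_coverP cover_a f; apply; first exact: var_ideal_ideal.
move=> _ [i [j [lt_j ->]]]; have iP := var_ideal_ideal k (var_box a (n - a)).
have [Ci|Cj] := orP (cover_a i j lt_j).
  by apply: ideal_mulr => //; apply: var_ideal_var; rewrite (mem_var_box (inl i)).
by apply: ideal_mull => //; apply: var_ideal_var; rewrite (mem_var_box (inr j)).
Qed.

(** A prime containing all products x_i y_j over the edges contains one factor of
    each, i.e. its variables form a vertex cover. *)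
Lemma prime_sup_corner (P : R -> Prop) :
    is_prime P -> sub_ideal I P ->
  exists2 a, corner a & sub_ideal (corner_prime a) P.
Proof.
move=> [iP _ primeP] IP.
have /fin_all_exists[c cP] : forall u, exists b : bool, b <-> P 'X_(unsplit u).
  move=> u; have [Pu|nPu] := classic (P 'X_(unsplit u)); first by exists true.
  by exists false; split.
have coverC : vertex_cover graph [set u | c u].
  apply/vertex_coverP => i j lt_j; rewrite !inE.
  have [/(cP (inl i))->//|/(cP (inr j))->] := primeP _ _ (IP _ (ferrers_ideal_edge lt_j)).
  exact: orbT.
have [a corner_a /subsetP sC] := cover_sup_corner coverC.
exists a => //; apply: var_ideal_min => // v; rewrite inE => /sC.
by rewrite inE => /cP; rewrite splitK.
Qed.

Lemma card_corner_box a : corner a -> #|var_box a (n - a)| = n.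
Proof.
by move=> /corner_le le_an; rewrite card_var_box ?leq_subr // subnKC.
Qed.

Lemma corner_primeU a b : (a <= b)%N ->
  ideal_add (corner_prime a) (corner_prime b) = var_ideal k (var_box b (n - a)).
Proof.
move=> le_ab; rewrite var_idealU var_boxU (maxn_idPr le_ab).
by rewrite (maxn_idPl (leq_sub2l n le_ab)).
Qed.

Lemma sub_corner_prime_eq a b :
  corner a -> corner b -> sub_ideal (corner_prime a) (corner_prime b) -> a = b.
Proof.
move=> corner_a corner_b /sub_var_ideal sab.
have le_an := corner_le corner_a; have le_bn := corner_le corner_b.
have : var_box a (n - a) = var_box b (n - b).
  by apply/eqP; rewrite eqEcard sab !card_corner_box /=.
move=> eq_ab; have := var_boxU a (n - a) b (n - b).
rewrite -eq_ab setUid => /(congr1 (fun A : {set _} => #|A|)).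
rewrite card_corner_box // card_var_box; lia.
Qed.

Lemma minimal_primeP (P : R -> Prop) :
  is_minimal_prime I P <-> exists2 a, corner a & P = corner_prime a.
Proof.
split=> [[primeP IP Pmin]|[a corner_a ->]].
  have [a corner_a aP] := prime_sup_corner primeP IP.
  exists a => //; apply: eq_idealP => f; split; last exact: aP.
  by apply: (Pmin _ _ _ aP); [apply: var_ideal_prime|apply: sub_corner_prime].
split=> [||Q primeQ IQ Qa]; [exact: var_ideal_prime|exact: sub_corner_prime|].
have [b corner_b bQ] := prime_sup_corner primeQ IQ.
suff <- : b = a by [].
by apply: sub_corner_prime_eq => // f /bQ /Qa.
Qed.

(** The edge ideal is radical: the variables missing from a monomial that no
    edge divides form a vertex cover. *)
Lemma ferrers_idealP f : I f <-> (forall a, corner a -> corner_prime a f).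
Proof.
split=> [If a corner_a|cap_f]; first exact: sub_corner_prime.
have iI := ferrers_ideal_ideal.
rewrite [f]mpolyE big_seq; apply: ideal_sum => // m fm; apply: (ideal_scale _ iI).
have [/existsP[i /existsP[j /and3P[lt_j mi mj]]]|no_edge] := boolP
    [exists i : 'I_n, exists j : 'I_n,
       [&& (j < tnth la i)%N, (0 < m (lshift n i))%N & (0 < m (rshift n j))%N]].
  have /submK<- : (U_(lshift n i) + U_(rshift n j) <= m)%MM.
    apply/mnm_lepP => v; rewrite mnmDE !mnm1E.
    case: eqP => [<-|_]; last by case: eqP => // <-.
    by rewrite eq_rlshift addn0.
  by rewrite !mpolyXD; apply: (ideal_mull _ iI); apply: ferrers_ideal_edge.
have coverC : vertex_cover graph [set u | m (unsplit u) == 0%N].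
  apply/vertex_coverP => i j lt_j; rewrite !inE -[_ || _]negbK negb_or -!lt0n.
  apply: contra no_edge => /andP[mi mj].
  by apply/existsP; exists i; apply/existsP; exists j; rewrite lt_j mi.
have [a corner_a /subsetP sC] := cover_sup_corner coverC.
have /var_idealP/(_ m fm)[v] := cap_f a corner_a.
by rewrite inE => /sC; rewrite inE splitK => /eqP->.
Qed.

Lemma mem_corner_prime a u :
  corner_prime a 'X_(unsplit u) <-> u \in corner_set n n a (n - a).
Proof. by rewrite /corner_prime var_ideal_varE mem_var_box. Qed.

Fixpoint corner_floor t : nat :=
  if t is t'.+1 then if corner t then t else corner_floor t' else 0%N.

Lemma corner_floor_corner t : corner (corner_floor t).
Proof. by elim: t => [|t IHt] /=; [exact: corner0|case: ifP]. Qed.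

Lemma corner_floor_le t : (corner_floor t <= t)%N.
Proof. by elim: t => [|t IHt] //=; case: ifP => // _; apply: leqW. Qed.

Lemma corner_floor_max a t : corner a -> (a <= t)%N -> (a <= corner_floor t)%N.
Proof.
move=> corner_a; elim: t => [|t IHt] //=.
rewrite leq_eqVlt => /predU1P[<-|]; first by rewrite corner_a.
by rewrite ltnS => /IHt le_a; case: ifP => // _;
  rewrite leqW // (leq_trans le_a) // corner_floor_le.
Qed.

Lemma corner_floor_id a : corner a -> corner_floor a = a.
Proof. by case: a => //= a ->. Qed.

(** No two consecutive corners are more than two apart: the corner that precedes
    t + 1 is [corner_floor t]. *)
Definition small_gaps : Prop :=
  forall t, corner t.+1 -> (t.+1 <= corner_floor t + 2)%N.

(** * Heights and dimension *)

Lemma height_corner_primeU a b :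
    corner a -> corner b -> (a <= b)%N ->
  is_height (ideal_add (corner_prime a) (corner_prime b)) (n + (b - a)).
Proof.
move=> corner_a corner_b le_ab; rewrite corner_primeU //.
have le_bn := corner_le corner_b.
have -> : (n + (b - a))%N = #|var_box b (n - a)| by rewrite card_var_box; lia.
exact: is_height_var_ideal.
Qed.

Lemma ferrers_height : is_height I n.
Proof.
split=> [|h [P [primeP IP heightP]]].
  exists (corner_prime 0); split; first exact: var_ideal_prime.
    exact/sub_corner_prime/corner0.
  by rewrite -[X in is_prime_height _ X](card_corner_box corner0); apply: var_ideal_height.
have [a corner_a aP] := prime_sup_corner primeP IP.
by rewrite -(card_corner_box corner_a); apply: height_over_var_ideal heightP.
Qed.

Lemma ferrers_dim_ge : exists ch, prime_chain ch n /\ sub_ideal I (ch 0%N).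
Proof.
have [ch [ch_prime ch0 _]] := var_ideal_chain k (subsetT (var_box 0 (n - 0))).
exists ch; split.
  by move: ch_prime; rewrite cardsT card_ord card_corner_box ?addnK //; apply: corner0.
by rewrite ch0; apply/sub_corner_prime/corner0.
Qed.

Lemma ferrers_dim : is_quotient_dim I n.
Proof.
split=> [|e [ch [ch_e Ich]]]; first exact: ferrers_dim_ge.
have [a corner_a aP] := prime_sup_corner (proj1 ch_e 0%N isT) Ich.
have [ch' [/prime_chain_leq + _]] := chain_over_var_ideal ch_e aP.
by rewrite card_corner_box // leq_add2l.
Qed.

(** * Connectedness in codimension two means small gaps *)

(** Walking from a to b in unit steps and rounding down to a corner gives a path
    of minimal primes whose jumps are at most two. *)
Lemma small_gaps_connected : small_gaps -> connected_in_codim 2 I.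
Proof.
move=> gaps.
have step t : (corner_floor t <= corner_floor t.+1 <= corner_floor t + 2)%N.
  rewrite /=; case: ifP => [corner_t|_]; last by rewrite leqnn leq_addr.
  by rewrite (leq_trans (corner_floor_le t)) //= gaps.
pose F t := corner_prime (corner_floor t).
have height_step t : exists hI h, [/\ is_height I hI,
    is_height (ideal_add (F t) (F t.+1)) h & (h <= hI + 2)%N].
  have /andP[le_t le_tS] := step t.
  exists n, (n + (corner_floor t.+1 - corner_floor t))%N; split.
  - exact: ferrers_height.
  - by apply: height_corner_primeU; rewrite // corner_floor_corner.
  - by rewrite leq_add2l leq_subLR.
have height_step' t : exists hI h, [/\ is_height I hI,
    is_height (ideal_add (F t.+1) (F t)) h & (h <= hI + 2)%N].
  have [hI [h [hgtI hgt le_h]]] := height_step t; exists hI, h; split=> //.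
  suff -> : ideal_add (F t.+1) (F t) = ideal_add (F t) (F t.+1) by [].
  by rewrite /F /corner_prime !var_idealU setUC.
have Fmin t : is_minimal_prime I (F t).
  by apply/minimal_primeP; exists (corner_floor t); rewrite ?corner_floor_corner.
move=> _ _ /minimal_primeP[a corner_a ->] /minimal_primeP[b corner_b ->] _.
have Fid c : corner c -> corner_prime c = F c by move=> /corner_floor_id; rewrite /F => ->.
have [le_ab|lt_ba] := leqP a b.
  exists (b - a)%N, (fun i => F (a + i)%N); split=> // [||i _].
  - by rewrite addn0 Fid.
  - by rewrite subnKC // Fid.
  - by rewrite addnS.
exists (a - b)%N, (fun i => F (a - i)%N); split=> // [||i lt_i].
- by rewrite subn0 Fid.
- by rewrite subKn 1?ltnW // Fid.
have -> : (a - i)%N = (a - i.+1).+1 by lia.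
exact: height_step'.
Qed.

Lemma connected_small_gaps : connected_in_codim 2 I -> small_gaps.
Proof.
move=> conn t corner_t; set b := corner_floor t.
have corner_b : corner b := corner_floor_corner t.
have le_bt : (b <= t)%N := corner_floor_le t.
have minprime c : corner c -> is_minimal_prime I (corner_prime c).
  by move=> corner_c; apply/minimal_primeP; exists c.
have [|r [ch [ch0 chr ch_min ch_step]]] := conn _ _ (minprime b corner_b) (minprime _ corner_t).
  move=> eq_bt; have : b = t.+1.
    by apply: sub_corner_prime_eq => // f; apply: (proj1 (eq_bt f)).
  lia.
(* a path from below the gap to above it has to jump over it *)
pose low i := exists a, [/\ corner a, (a <= b)%N & ch i = corner_prime a].
have low0 : low 0%N by exists b.
have nlow_r : ~ low r.
  case=> a [corner_a le_ab]; rewrite chr => eq_a.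
  have : t.+1 = a by apply: sub_corner_prime_eq; rewrite // eq_a.
  lia.
have [i lt_ir [[a [corner_a le_ab chi]] nlow_i]] : exists2 i, (i < r)%N & low i /\ ~ low i.+1.
  apply: NNPP => no_jump; apply: nlow_r; move: (leqnn r).
  elim: {-2}r => [//|i IHi] lt_ir; apply: NNPP => nlow_i.
  by apply: no_jump; exists i => //; split=> //; apply: IHi; apply: ltnW.
have /minimal_primeP[a' corner_a' chi'] := ch_min i.+1 lt_ir.
have lt_ta' : (t < a')%N.
  rewrite ltnNge; apply/negP => le_a't; apply: nlow_i; exists a'; split=> //.
  exact: corner_floor_max.
have [hI [h [hgtI + le_h]]] := ch_step i lt_ir.
have le_aa' : (a <= a')%N by lia.
rewrite chi chi' => /is_height_uniq/(_ (height_corner_primeU corner_a corner_a' le_aa')).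
have := is_height_uniq hgtI ferrers_height; lia.
Qed.

(** * Depth of the quotient by the edge ideal *)

Lemma ferrers_ideal_linear f v : I f -> f@_U_(v) = 0.
Proof.
move=> /ferrers_idealP If; apply/eqP; rewrite mcoeff_eq0; apply/negP => fv.
have mem_v a : corner a -> v \in var_box a (n - a).
  move=> /If/var_idealP/(_ _ fv)[w Sw]; rewrite mnm1E.
  by case: eqP => // ->.
have := mem_v 0%N corner0; have := mem_v n corner_n; rewrite !inE.
by case: (split v) => i //; rewrite subnn.
Qed.

(** A gap between consecutive corners b < t + 1 makes every product of a variable
    x_i, i <= t, with a variable y_j, j < n - b, vanish modulo the edge ideal. *)
Lemma ferrers_regular_size s t :
    weakly_regular I s -> (forall f, f \in s -> f@_0%MM = 0) -> corner t.+1 ->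
  (size s <= n - t.+1 + corner_floor t + 1)%N.
Proof.
move=> reg_s s0 corner_t; set b := corner_floor t.
have le_bt : (b <= t)%N := corner_floor_le t.
have le_tn := corner_le corner_t.
have cardX : #|var_box t.+1 0| = t.+1 by rewrite card_var_box ?addn0.
have cardY : #|var_box 0 (n - b)| = (n - b)%N by rewrite card_var_box ?leq_subr.
have := @regular_size_leq k _ I (var_box t.+1 0) (var_box 0 (n - b)) s
  ferrers_ideal_ideal ferrers_ideal_linear.
rewrite var_boxU maxn0 max0n => size_s; apply: leq_trans (size_s _ _ _ _ reg_s s0) _.
- rewrite -setI_eq0; apply/eqP/setP => v; rewrite !inE.
  by case: (split v) => i; rewrite !ltn0 ?andbF.
- by rewrite -card_gt0 cardX.
- by rewrite -card_gt0 cardY; lia.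
- move=> v w; rewrite -(splitK v) -(splitK w) !mem_var_box => Xv Yw.
  apply/ferrers_idealP => a corner_a; have iP := var_ideal_ideal k (var_box a (n - a)).
  have [le_at|lt_ta] := leqP a t.
    apply: (ideal_mull _ iP); apply/mem_corner_prime.
    have := corner_floor_max corner_a le_at; rewrite -/b => le_ab.
    by move: Yw; rewrite !inE; case: (split w) => // j; lia.
  apply: (ideal_mulr _ iP); apply/mem_corner_prime.
  by move: Xv; rewrite !inE; case: (split v) => // j; lia.
have := cardsC (var_box t.+1 (n - b)); rewrite card_ord card_var_box ?leq_subr //.
lia.
Qed.

(** The last gap, which ends at the corner n, has length at least one. *)
Lemma ferrers_regular_size_n s :
  weakly_regular I s -> (forall f, f \in s -> f@_0%MM = 0) -> (size s <= n)%N.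
Proof.
move=> reg_s s0; have : corner n.-1.+1 by rewrite prednK ?corner_n.
move/(ferrers_regular_size reg_s s0).
have := corner_floor_le n.-1; lia.
Qed.

Lemma almost_CM_small_gaps : almost_CM I -> small_gaps.
Proof.
move=> [depth [dim [[[s [size_s s0 reg_s]] _] [_ dim_max] le_depth]]] t corner_t.
have /quotient_regularE[] := reg_s; first exact: ferrers_ideal_ideal.
move=> /ferrers_regular_size/(_ s0 corner_t) + _; rewrite size_s.
have := dim_max n ferrers_dim_ge.
have := corner_le corner_t; lia.
Qed.

(** x_j + y_(n-1-j), read as 0 for j >= n: modulo any corner prime exactly one of
    its two variables survives. *)
Definition diagonal_coef (j : nat) (v : 'I_(n + n)) : k :=
  match split v with inl i => (i == j :> nat)%:R | inr i => (i + j.+1 == n)%N%:R end.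

Definition diagonal_form j : R := linear_form (diagonal_coef j).

(** Differences of forms two steps apart: the forms in a gap of length at most
    two, which all vanish on a sum of two neighbouring corner primes, then never
    meet in a single difference. *)
Definition diagonal_seq : seq R :=
  [seq diagonal_form j - diagonal_form j.+2 | j <- iota 0 n.-1].

Lemma size_diagonal_seq : size diagonal_seq = n.-1.
Proof. by rewrite size_map size_iota. Qed.

Lemma nth_diagonal_seq j :
  (j < n.-1)%N -> diagonal_seq`_j = diagonal_form j - diagonal_form j.+2.
Proof. by move=> lt_j; rewrite (nth_map 0%N) ?size_iota // nth_iota. Qed.

Lemma diagonal_seq_linear f : f \in diagonal_seq -> is_linear_form f.
Proof.
move=> /mapP[j _ ->]; rewrite /diagonal_form linear_formB.
by exists (fun v => diagonal_coef j v - diagonal_coef j.+2 v).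
Qed.

(** A common zero of the variables in [var_box b (n - a)] at which the diagonal
    forms that survive modulo these variables take the values [t]. *)
Definition diagonal_point (a b : nat) (t : nat -> k) (v : 'I_(n + n)) : k :=
  match split v with
  | inl i => (b <= i)%N%:R * t i
  | inr i => (n - a <= i)%N%:R * t (n - i.+1)%N
  end.

Lemma sum_delta (F : 'I_n -> k) (G : nat -> k) (p : 'I_n -> bool) j :
    (forall i, p i = (i == j :> nat)) -> (forall i, F i = G i) ->
  \sum_i (p i)%:R * F i = (j < n)%N%:R * G j.
Proof.
move=> pE FE; have [lt_j|le_j] := ltnP j n.
  rewrite (bigD1 (Ordinal lt_j)) //= pE eqxx FE big1 ?addr0 // => i.
  by rewrite -val_eqE /= pE => /negPf->; rewrite mul0r.
rewrite mul0r big1 // => i _; rewrite pE (_ : _ == _ = false) ?mul0r //.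
by apply: ltn_eqF; apply: leq_trans le_j.
Qed.

Lemma eval_diagonal_form a b t j : (a <= n)%N ->
  (diagonal_form j).@[diagonal_point a b t]
  = (j < n)%N%:R * ((b <= j)%N%:R + (j < a)%N%:R) * t j.
Proof.
move=> le_an; rewrite meval_linear_form big_split_ord /=.
rewrite /diagonal_coef /diagonal_point.
under eq_bigr do rewrite -[lshift n _]/(unsplit (inl _)) unsplitK.
under [X in _ + X]eq_bigr do rewrite -[rshift n _]/(unsplit (inr _)) unsplitK.
rewrite (sum_delta (G := fun i => (b <= i)%N%:R * t i) (j := j)) //.
have [lt_j|le_j] := ltnP j n; last first.
  rewrite !mul0r add0r big1 // => i _; rewrite (_ : _ == _ = false) ?mul0r //; lia.
rewrite (sum_delta (G := fun i => (n - a <= i)%N%:R * t (n - i.+1)%N)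
  (j := (n - j.+1)%N)) // => [|i]; last by lia.
have -> : (n - j.+1 < n)%N by lia.
have -> : (n - (n - j.+1).+1)%N = j by lia.
have -> : (n - a <= n - j.+1)%N = (j < a)%N by lia.
by ring.
Qed.

Lemma eval_var_box a b t v :
  v \in var_box b (n - a) -> ('X_v : R).@[diagonal_point a b t] = 0.
Proof.
rewrite mevalXU /diagonal_point !inE; case: (split v) => i lt_i.
  by rewrite leqNgt lt_i mul0r.
by rewrite leqNgt lt_i mul0r.
Qed.

(** Each form of the sequence is separated from the earlier ones by the point
    whose diagonal values are 1 along the progression of step two that ends at
    its first index, or starts at its second index when the gap comes first. *)
Lemma diagonal_seq_regular a b l :
    (a <= b <= n)%N -> (b <= a + 2)%N -> (l <= n.-1)%N -> a = b \/ (l <= n - 2)%N ->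
  weakly_regular (var_ideal k (var_box b (n - a))) (take l diagonal_seq).
Proof.
move=> /andP[le_ab le_bn] le_ba2 le_l ab_l.
have le_an := leq_trans le_ab le_bn.
apply: linear_regular => [f|i].
  rewrite mem_cat => /orP[/mapP[v _ ->]|/mem_take/diagonal_seq_linear //].
  by exists (fun w => (w == v)%:R); apply: linear_form_delta.
rewrite size_takel ?size_diagonal_seq // => lt_il.
have lt_in : (i < n.-1)%N by lia.
pose t1 j : k := ((j <= i)%N && (odd j == odd i))%:R.
pose t2 j : k := ((i.+2 <= j)%N && (odd j == odd i))%:R.
have evalE t j : (j < n.-1)%N ->
    (diagonal_seq`_j).@[diagonal_point a b t] =
    (j < n)%N%:R * ((b <= j)%N%:R + (j < a)%N%:R) * t j
    - (j.+2 < n)%N%:R * ((b <= j.+2)%N%:R + (j.+2 < a)%N%:R) * t j.+2.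
  by move=> lt_j; rewrite nth_diagonal_seq // mevalB !eval_diagonal_form.
have [ia|nia] := boolP ((i < a)%N || (a == b)).
  exists (diagonal_point a b t1); split=> [f|j lt_ji|].
  - by case/mapP=> v; rewrite mem_enum => Sv ->; apply: eval_var_box.
  - rewrite nth_take // ?(ltn_trans lt_ji) //.
    rewrite evalE; last by lia.
    rewrite /t1 /= negbK (_ : (j <= i)%N); last by lia.
    case: eqP => par; rewrite ?andbF ?mulr0 ?subr0 //.
    have lt_j2 : (j.+2 <= i)%N by move: par => /(congr1 nat_of_bool); lia.
    rewrite lt_j2.
    have -> : (j < n)%N by lia. have -> : (j.+2 < n)%N by lia.
    have -> : (b <= j)%N = ~~ (j < a)%N by lia.
    have -> : (b <= j.+2)%N = ~~ (j.+2 < a)%N by lia.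
    by do 2!case: (_ < a)%N; rewrite /= ?addr0 ?add0r subrr.
  rewrite nth_take // evalE // /t1 /= leqnn eqxx /=.
  have -> : (i < n)%N by lia.
  have -> : (b <= i)%N = ~~ (i < a)%N by lia.
  have -> : (i.+2 <= i)%N = false by lia.
  by rewrite mulr0 subr0; case: (i < a)%N; rewrite ?addr0 ?add0r !mulr1 oner_eq0.
move: nia; rewrite negb_or -leqNgt => /andP[le_ai neq_ab].
have le_ln2 : (l <= n - 2)%N by case: ab_l neq_ab => // ->; rewrite eqxx.
exists (diagonal_point a b t2); split=> [f|j lt_ji|].
- by case/mapP=> v; rewrite mem_enum => Sv ->; apply: eval_var_box.
- rewrite nth_take // ?(ltn_trans lt_ji) //.
  rewrite evalE; last by lia.
  rewrite /t2 (_ : (i.+2 <= j)%N = false); last by lia.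
  by rewrite (_ : (i.+2 <= j.+2)%N = false) ?mulr0 ?subr0 //; lia.
rewrite nth_take // evalE // /t2 /= negbK leqnn eqxx.
have -> : (i.+2 <= i)%N = false by lia.
have -> : (i.+2 < n)%N by lia.
have -> : (b <= i.+2)%N by lia.
have -> : (i.+2 < a)%N = false by lia.
by rewrite mulr0 sub0r addr0 !mulr1 oppr_eq0 oner_eq0.
Qed.

Definition corners_upto c : R -> Prop :=
  fun f => forall a, (a <= c)%N -> corner a -> corner_prime a f.

Lemma corners_upto_ideal c : is_ideal (corners_upto c).
Proof.
split=> [a _ _|x y Px Py a le_ac corner_a|z x Px a le_ac corner_a].
- exact: (ideal_zero (var_ideal_ideal k (var_box a (n - a)))).
- by apply: ideal_plus; [exact: var_ideal_ideal|exact: Px|exact: Py].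
- by apply: ideal_mull; [exact: var_ideal_ideal|exact: Px].
Qed.

(** The edge ideal is built up by intersecting with one corner prime at a time;
    the sum in the resulting exact sequence only sees the preceding corner. *)
Lemma corners_upto_regular c :
  small_gaps -> (c <= n)%N -> weakly_regular (corners_upto c) diagonal_seq.
Proof.
move=> gaps; elim: c => [|c IHc] le_cn.
  have -> : corners_upto 0 = var_ideal k (var_box 0 (n - 0)).
    apply: eq_idealP => f; split=> [|Pf a]; first by apply=> //; apply: corner0.
    by rewrite leqn0 => /eqP->.
  rewrite -[diagonal_seq]take_size size_diagonal_seq.
  by apply: diagonal_seq_regular => //; left.
have [corner_c|ncorner_c] := boolP (corner c.+1); last first.
  have -> : corners_upto c.+1 = corners_upto c.
    apply: eq_idealP => f; split=> Pf a le_ac corner_a; apply: Pf => //.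
      exact: leqW.
    move: le_ac; rewrite leq_eqVlt => /predU1P[aE|//].
    by rewrite aE (negPf ncorner_c) in corner_a.
  exact/IHc/ltnW.
have -> : corners_upto c.+1 = ideal_cap (corners_upto c) (corner_prime c.+1).
  apply: eq_idealP => f; split=> [Pf|[Pf Pcf] a le_ac corner_a].
    by split=> [a le_ac corner_a|]; apply: Pf; rewrite // leqW.
  by move: le_ac; rewrite leq_eqVlt => /predU1P[->//|le_ac]; apply: Pf.
have le_fl := corner_floor_le c; have gap_c := gaps c corner_c.
apply: weakly_regular_cap; first exact: corners_upto_ideal.
- exact: var_ideal_ideal.
- exact/IHc/ltnW.
- rewrite -[diagonal_seq]take_size size_diagonal_seq.
  by apply: diagonal_seq_regular; rewrite ?leqnn //; [lia|left].
have -> : ideal_add (corners_upto c) (corner_prime c.+1) =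
    var_ideal k (var_box c.+1 (n - corner_floor c)).
  rewrite -corner_primeU; last by lia.
  have iU := corners_upto_ideal c.
  have iP a : is_ideal (corner_prime a) by apply: var_ideal_ideal.
  apply: eq_idealP => f; split; move: f.
    apply: ideal_add_min; first exact: ideal_add_ideal.
      by move=> f Uf; apply: ideal_addl => //; apply: Uf => //; apply: corner_floor_corner.
    by move=> f Pf; apply: ideal_addr.
  apply: ideal_add_min; first exact: ideal_add_ideal.
    apply: var_ideal_min; first exact: ideal_add_ideal.
    move=> v; rewrite -(splitK v) mem_var_box.
    case: (split v) => i; rewrite inE => lt_i.
      apply: ideal_addr => //; apply/mem_corner_prime; rewrite inE; lia.
    apply: ideal_addl => // a le_ac corner_a; apply/mem_corner_prime.
    have := corner_floor_max corner_a le_ac; rewrite inE; lia.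
  by move=> f Pf; apply: ideal_addr.
rewrite size_diagonal_seq; apply: diagonal_seq_regular; [lia|lia|lia|right; lia].
Qed.

Lemma irrelevant_ideal : is_ideal (fun f : R => f@_0%MM = 0).
Proof.
split=> [|x y|a x]; first exact: mcoeff0.
  by rewrite mcoeffD => -> ->; rewrite addr0.
by rewrite rmorphM /= => ->; rewrite mulr0.
Qed.

Lemma linear_form_irrelevant (f : R) : is_linear_form f -> f@_0%MM = 0.
Proof.
case=> c ->; rewrite raddf_sum big1 // => v _ /=.
by rewrite mcoeffZ mcoeffX mnm1_eq0 mulr0.
Qed.

Lemma corner_prime_irrelevant a (f : R) : corner_prime a f -> f@_0%MM = 0.
Proof.
move=> /var_idealP supp_f; apply: memN_msupp_eq0; apply/negP => /supp_f[v _].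
by rewrite mnm0E.
Qed.

(** The diagonal sequence has length n - 1 and no regular sequence is longer than
    n, so the depth is one of these two numbers. *)
Lemma small_gaps_almost_CM : small_gaps -> almost_CM I.
Proof.
move=> gaps.
have IE : I = corners_upto n.
  apply: eq_idealP => f; rewrite ferrers_idealP.
  by split=> If a => [_|corner_a]; apply: If => //; apply: corner_le.
have iI := ferrers_ideal_ideal.
have diag0 f : f \in diagonal_seq -> f@_0%MM = 0.
  by move/diagonal_seq_linear/linear_form_irrelevant.
have reg_diag : quotient_regular I diagonal_seq.
  apply/quotient_regularE => //; split; first by rewrite IE; apply: corners_upto_regular.
  move=> I1; have : (1 : R)@_0%MM = 0.
    apply: (adjoins_min irrelevant_ideal _ diag0 I1) => f /ferrers_idealP/(_ _ corner0).
    exact: corner_prime_irrelevant.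
  by rewrite mcoeff1 eqxx => /eqP; rewrite oner_eq0.
have depth_le e : (exists s : seq R, [/\ size s = e,
    forall f, f \in s -> f@_0%MM = 0 & quotient_regular I s]) -> (e <= n)%N.
  case=> s [<- s0 /quotient_regularE[] // reg_s _].
  exact: ferrers_regular_size_n.
have depth_pred : exists s : seq R, [/\ size s = n.-1,
    forall f, f \in s -> f@_0%MM = 0 & quotient_regular I s].
  by exists diagonal_seq; rewrite size_diagonal_seq.
have [depth_n|ndepth_n] := classic (exists s : seq R, [/\ size s = n,
    forall f, f \in s -> f@_0%MM = 0 & quotient_regular I s]).
  by exists n, n; split; [split|exact: ferrers_dim|exact: leq_subr].
exists n.-1, n; split; [split=> // e depth_e|exact: ferrers_dim|by rewrite subn1].
have := depth_le e depth_e; rewrite leq_eqVlt => /predU1P[eE|]; last by lia.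
case: depth_e => s [sE s0 reg_s]; case: ndepth_n; exists s; split=> //.
by rewrite sE.
Qed.

End SquareFerrers.

Theorem theorem3p6 (k : fieldType) (n m : nat) (la : n.-tuple nat)
  (n_gt0 : 0 < n)
  (la_gt0 : forall i : 'I_n, 0 < tnth la i)
  (la_noninc : forall i j : 'I_n, i <= j -> tnth la j <= tnth la i)
  (la_head : nth 0 la 0 = m)
  (G_unmixed : unmixed (@ferrers_graph n m la)) :
  almost_CM (@ferrers_ideal n m la k) <->
  connected_in_codim 2 (@ferrers_ideal n m la k).
Proof.
have mn := ferrers_square la_gt0 la_head n_gt0 la_noninc G_unmixed.
move: la_head G_unmixed; rewrite {m}mn => la_head G_unmixed; split=> [aCM|conn].
  by apply: small_gaps_connected => //; apply: almost_CM_small_gaps aCM.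
by apply: small_gaps_almost_CM => //; apply: connected_small_gaps conn.
Qed.
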